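(* Let $d\ge2$. Let $v$ be a supersolution and $u$ a subsolution of $$\Delta u=0 \text{ in } B_1^+,\qquad \min\{\partial_1u,|\nabla' u|\}=0 \text{ on } B_1',$$ and suppose that $u$ satisfies in addition the boundary maximum principle: for every subdomain $\Omega\subset\subset B_1'$, $$\max_{\overline{\Omega}}u=\max_{\partial'\Omega}u .$$ If $v\ge u$ on $\partial B_1\cap\{x_1\ge0\}$, then $v\ge u$ on $\overline{B_1^+}$.
   Context: Write $x=(x_1,x')\in\mathbb{R}\times\mathbb{R}^{d-1}$, $\nabla'=(\partial_2,\dots,\partial_d)$, $B_r=B_r(0)\subset\mathbb{R}^d$, $B_r^+=B_r\cap\{x_1>0\}$, $B_r'=B_r\cap\{x_1=0\}$. For a subdomain $\Omega$ of $B_1'$ (relatively open in $\{x_1=0\}$), $\partial'\Omega$ is its relative boundary in $\{x_1=0\}$. A subsolution of the problem $\Delta u=0$ in $B_1^+$, $\min\{\partial_1u,|\nabla'u|\}=0$ on $B_1'$ is an upper semicontinuous function $u$ on $\overline{B_1^+}$ that is subharmonic in $B_1^+$ and such that whenever a smooth $\varphi$ touches $u$ from above at $x_0\in B_1'$ (i.e. $\varphi(x_0)=u(x_0)$ and $\varphi\ge u$ in $\overline{B_1^+}$ near $x_0$) with $\Delta\varphi(x_0)<0$, then $\partial_1\varphi(x_0)\ge0$. A supersolution is a lower semicontinuous function $u$ on $\overline{B_1^+}$ that is superharmonic in $B_1^+$ and such that whenever a smooth $\varphi$ touches $u$ from below at $x_0\in B_1'$ with $\Delta\varphi(x_0)>0$,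 then $\min\{\partial_1\varphi(x_0),|\nabla'\varphi(x_0)|\}\le0$ (i.e. if $|\nabla'\varphi(x_0)|>0$ then $\partial_1\varphi(x_0)\le0$). *)

(* Defs.v *)
From HB Require Import structures.
From mathcomp Require Import all_boot all_order all_algebra.
From mathcomp Require Import all_classical all_reals all_analysis.
Import Order.TTheory GRing.Theory Num.Theory.
Import numFieldNormedType.Exports.

Set Implicit Arguments.
Unset Strict Implicit.
Unset Printing Implicit Defensive.

Local Open Scope classical_set_scope.
Local Open Scope ring_scope.

(* The space R^d is 'rV[R]_n.+1 with d = n.+1; the
   coordinate x_1 is indexed by ord0, the tangential ones by i != ord0. *)

Section Geometry.
Context {R : realType} {n : nat}.
Local Notation E := 'rV[R]_n.+1.

(* The library norm on row vectors is the sup norm (it induces the same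
   topology), hence an explicit Euclidean norm for the balls. *)
Definition enorm (x : E) : R := Num.sqrt (\sum_i (x ord0 i) ^+ 2).

Definition x1 (x : E) : R := x ord0 ord0.

Definition eball (c : E) (r : R) : set E := [set x | enorm (x - c) < r].
Definition ecball (c : E) (r : R) : set E := [set x | enorm (x - c) <= r].
Definition esphere (c : E) (r : R) : set E := [set x | enorm (x - c) = r].

Definition hyperplane : set E := [set x | x1 x = 0].

(* B_r^+ and B_r' *)
Definition half_ball (r : R) : set E := eball 0 r `&` [set x | 0 < x1 x].
Definition flat_ball (r : R) : set E := eball 0 r `&` hyperplane.

Definition rel_boundary (A : set E) : set E :=
  closure A `&` closure (hyperplane `\` A) `&` hyperplane.

Definition subdomain (U A : set E) : Prop :=
  [/\ A `<=` U, A !=set0, connected A &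
      exists2 V : set E, open V & A = V `&` hyperplane].

Definition compactly_contained (A U : set E) : Prop :=
  compact (closure A) /\ closure A `<=` U.

End Geometry.

Section Calculus.
Context {R : realType} {n : nat}.
Local Notation E := 'rV[R]_n.+1.

Definition basis_vec (i : 'I_n.+1) : E := delta_mx ord0 i.

Definition partial (i : 'I_n.+1) (f : E -> R) : E -> R := 'D_(basis_vec i) f.

Definition laplacian (f : E -> R) (x : E) : R :=
  \sum_i partial i (partial i f) x.

Definition tangential_grad_norm (f : E -> R) (x : E) : R :=
  Num.sqrt (\sum_(i | i != ord0) (partial i f x) ^+ 2).

(* f is of class C^k on the open set U *)
Fixpoint Ck (U : set E) (k : nat) (f : E -> R) : Prop :=
  (forall x, U x -> {for x, continuous f}) /\
  match k with
  | 0 => True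
  | k'.+1 => forall i, (forall x, U x -> derivable f x (basis_vec i)) /\
                       Ck U k' (partial i f)
  end.

Definition smooth (f : E -> R) : Prop := forall k, Ck setT k f.

Definition harmonic_on (U : set E) (h : E -> R) : Prop :=
  Ck U 2 h /\ forall x, U x -> laplacian h x = 0.

End Calculus.

Section Viscosity.
Context {R : realType} {n : nat}.
Local Notation E := 'rV[R]_n.+1.

(* A real-valued function on a subset A of R^d is represented by a total
   function of which only the values on A matter: semicontinuity is taken on
   the subspace A. *)
Definition lsc_on (A : set E) (f : E -> R) : Prop :=
  lower_semicontinuous (fun x : subspace A => (f x)%:E).

Definition usc_on (A : set E) (f : E -> R) : Prop := lsc_on A (\- f).

Definition subharmonic_on (U : set E) (u : E -> R) : Prop :=
  usc_on U u /\
  forall (c : E) (r : R) (h : E -> R), 0 < r -> ecball c r `<=` U ->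
    {within ecball c r, continuous h} -> harmonic_on (eball c r) h ->
    (forall x, esphere c r x -> u x <= h x) ->
    forall x, ecball c r x -> u x <= h x.

Definition superharmonic_on (U : set E) (u : E -> R) : Prop :=
  subharmonic_on U (\- u).

Definition touches_above (A : set E) (phi u : E -> R) (x0 : E) : Prop :=
  phi x0 = u x0 /\ \forall x \near x0, A x -> u x <= phi x.

Definition touches_below (A : set E) (phi u : E -> R) (x0 : E) : Prop :=
  phi x0 = u x0 /\ \forall x \near x0, A x -> phi x <= u x.

Definition subsolution (u : E -> R) : Prop :=
  [/\ usc_on (closure (half_ball 1)) u,
      subharmonic_on (half_ball 1) u &
      forall (x0 : E) (phi : E -> R), flat_ball 1 x0 -> smooth phi ->
        touches_above (closure (half_ball 1)) phi u x0 ->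
        laplacian phi x0 < 0 -> 0 <= partial ord0 phi x0].

Definition supersolution (v : E -> R) : Prop :=
  [/\ lsc_on (closure (half_ball 1)) v,
      superharmonic_on (half_ball 1) v &
      forall (x0 : E) (phi : E -> R), flat_ball 1 x0 -> smooth phi ->
        touches_below (closure (half_ball 1)) phi v x0 ->
        0 < laplacian phi x0 ->
        Num.min (partial ord0 phi x0) (tangential_grad_norm phi x0) <= 0].

Definition is_max (f : E -> R) (A : set E) (m : R) : Prop :=
  (exists2 x, A x & f x = m) /\ forall x, A x -> f x <= m.

(* Both maxima exist and are equal. *)
Definition boundary_max_principle (u : E -> R) : Prop :=
  forall Omega : set E, subdomain (flat_ball 1) Omega ->
    compactly_contained Omega (flat_ball 1) ->
    exists m : R, is_max u (closure Omega) m /\ is_max u (rel_boundary Omega) m.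

End Viscosity.

(* Main.v *)
(* Let M > 0 be the maximum of u - v. For a tangential vector e, the difference
   u(x + e) + eta (x_1 + x_1^2) - v(x) is strictly subharmonic, so it has no
   interior maximum, and at a maximum on the hyperplane it forces a gap between
   the normal slopes of u and v. Doubling variables with the penalization
   |y - x - e|^2 / (2 eps) gives u and v the common tangential slope
   (y - x - e) / eps at a maximum; if it were nonzero, both boundary conditions
   would apply and contradict the gap. Hence y - x = e, the maximum m(e) of the
   difference satisfies m(e) <= m(e') + |e - e'|^2 / (2 eps), and m is constant.
   This persists after subtracting a small tau |x - z|^2 from u.

   Constancy of m shows that a contact point is a local maximum of u and a
   local minimum of v on the hyperplane, with a uniform radius, and (by choosing
   tau > 0) that every nearby point where u has the same value is a contact
   point. A component of a small neighborhood of such a level of the contact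
   set then violates the boundary maximum principle of u.

   Integrals are avoided: the only harmonic functions used are polynomials,
   which separate an upper semicontinuous function from a larger lower
   semicontinuous one on any sphere. *)

(* At a contact point on the hyperplane neither function need have a normal derivative, so the two
   boundary conditions cannot be compared directly. Both test functions are built around one odd
   harmonic polynomial, inserted between the remainders of [u] and [v]: its normal slope is unknown,
   but it enters both conditions and cancels. Being odd, it leaves the tangential slopes alone, and
   the condition on [v] says something only if its tangential slope is nonzero.

   Subharmonicity is available only against functions harmonic on balls, so [|s|^2] is replaced by
   [|s|^2 - d s_1^2], equal to it on the hyperplane, or by an affine function equal to it on a
   sphere.

   A polynomial agrees on a sphere with a harmonic polynomial. Insertion thus reduces to
   approximating Lipschitz functions by polynomials, which follows from a second moment estimate for
   a random walk.

   The parameter tau locates contact points: if [z] lies near a contact point and [u] has the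
   contact value there, sliding yields a contact point [w] with [tau |w - z|^2 <= 0]. *)
Require Import Defs.
From HB Require Import structures.
From mathcomp Require Import all_boot all_order all_algebra.
From mathcomp Require Import ring lra.
From mathcomp Require Import all_classical all_reals all_analysis.
Import Order.TTheory GRing.Theory Num.Theory.
Import numFieldNormedType.Exports.

Set Implicit Arguments.
Unset Strict Implicit.
Unset Printing Implicit Defensive.

Local Open Scope classical_set_scope.
Local Open Scope ring_scope.

(** * Polynomial functions *)

Section PolynomialFunctions.
Context {R : realType} {n : nat}.
Local Notation E := 'rV[R]_n.+1.
Implicit Types (f g h : E -> R) (x y s c : E) (i j : 'I_n.+1).

(** The only product is with one coordinate, because that is the step which [harmpoly_coordM]
    handles in the induction of [dirichlet_sphere]. General products are recovered in [polyfunM]. *)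
Inductive polyfun : (E -> R) -> Prop :=
| polyfun_cst a : polyfun (fun=> a)
| polyfunD f g : polyfun f -> polyfun g -> polyfun (fun x => f x + g x)
| polyfun_coordM i f : polyfun f -> polyfun (fun x => x ord0 i * f x).

Lemma polyfunM f g : polyfun f -> polyfun g -> polyfun (fun x => f x * g x).
Proof.
move=> + pg; elim=> [a|f1 f2 _ IH1 _ IH2|i f1 _ IH1].
- elim: pg => [b|g1 g2 _ IH1 _ IH2|i g1 _ IH].
  + exact: polyfun_cst.
  + under eq_fun do rewrite mulrDr; exact: polyfunD.
  + under eq_fun do rewrite mulrCA; exact: polyfun_coordM.
- under eq_fun do rewrite mulrDl; exact: polyfunD.
- under eq_fun do rewrite -mulrA; exact: polyfun_coordM.
Qed.

Lemma polyfunZ a f : polyfun f -> polyfun (fun x => a * f x).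
Proof. exact/polyfunM/polyfun_cst. Qed.

Lemma polyfun_coord i : polyfun (fun x => x ord0 i).
Proof.
rewrite (_ : (fun x => _) = (fun x : E => x ord0 i * 1)).
  exact/polyfun_coordM/polyfun_cst.
by apply/funext => x; rewrite mulr1.
Qed.

Lemma polyfunN f : polyfun f -> polyfun (fun x => - f x).
Proof. by move=> pf; under eq_fun do rewrite -mulN1r; exact: polyfunZ. Qed.

Lemma polyfunB f g : polyfun f -> polyfun g -> polyfun (fun x => f x - g x).
Proof. by move=> pf /polyfunN; exact: polyfunD. Qed.

Lemma polyfun_sum (I : Type) (r : seq I) (F : I -> E -> R) :
  (forall k, polyfun (F k)) -> polyfun (fun x => \sum_(k <- r) F k x).
Proof.
move=> pF; elim: r => [|k r IH].
  by under eq_fun do rewrite big_nil; exact: polyfun_cst.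
by under eq_fun do rewrite big_cons; exact: polyfunD.
Qed.

Lemma polyfun_comp_aff (rho : 'I_n.+1 -> R) c f : polyfun f ->
  polyfun (fun x => f (\row_i (rho i * x ord0 i + c ord0 i))).
Proof.
elim=> [a|f1 f2 _ IH1 _ IH2|i f1 _ IH1]; first exact: polyfun_cst.
  exact: polyfunD.
apply: polyfunM => //; under eq_fun do rewrite mxE.
by apply: polyfunD; [exact/polyfunZ/polyfun_coord|exact: polyfun_cst].
Qed.

Lemma polyfun_shift c f : polyfun f -> polyfun (fun x => f (x - c)).
Proof.
move=> /(polyfun_comp_aff (fun=> 1) (- c)); congr (polyfun _); apply/funext => x.
by congr f; apply/rowP => i; rewrite !mxE mul1r.
Qed.

Definition mirror (x : E) : E :=
  \row_i (if i == ord0 then - x ord0 i else x ord0 i).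

Lemma mirrorK : involutive mirror.
Proof. by move=> x; apply/rowP => i; rewrite !mxE; case: eqP; rewrite ?opprK. Qed.

Lemma polyfun_mirror f : polyfun f -> polyfun (f \o mirror).
Proof.
move=> /(polyfun_comp_aff (fun i => if i == ord0 then -1 else 1) 0).
congr (polyfun _); apply/funext => x /=; congr f; apply/rowP => i.
by rewrite !mxE addr0; case: ifP; rewrite ?mulN1r ?mul1r.
Qed.

Lemma polyfun_continuous f : polyfun f -> continuous f.
Proof.
elim=> [a|f1 f2 _ IH1 _ IH2|i f1 _ IH1] x; first exact: cst_continuous.
  exact: (cvgD (IH1 x) (IH2 x)).
exact: (cvgM (@coord_continuous R _ _ ord0 i x) (IH1 x)).
Qed.

Lemma polyfun_differentiable f x : polyfun f -> differentiable f x.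
Proof.
elim=> [a|f1 f2 _ IH1 _ IH2|i f1 _ IH1]; first exact: differentiable_cst.
  exact: differentiableD.
by apply: differentiableM => //; exact: differentiable_coord.
Qed.

Lemma polyfun_derivable f x v : polyfun f -> derivable f x v.
Proof. by move=> pf; exact/diff_derivable/polyfun_differentiable. Qed.

Lemma partial_cst i a : partial i (fun=> a : R) = (fun=> 0).
Proof. by apply/funext => x; rewrite /partial derive_cst. Qed.

Lemma partialD i f g : polyfun f -> polyfun g ->
  partial i (fun x => f x + g x) = (fun x => partial i f x + partial i g x).
Proof.
by move=> pf pg; apply/funext => x; apply: deriveD; exact: polyfun_derivable.
Qed.

Lemma partial_coord i j : partial i (fun x => x ord0 j) = (fun=> (i == j)%:R).
Proof.
apply/funext => x; rewrite /partial /derive.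
apply/cvg_lim; first exact: norm_hausdorff.
apply: cvg_near_cst; near=> h.
have h0 : h != 0 by near: h; exact: nbhs_dnbhs_neq.
by rewrite /basis_vec /= !mxE eqxx /= addrK eq_sym; exact: mulKf.
Unshelve. all: by end_near. Qed.

Lemma partialM i f g : polyfun f -> polyfun g ->
  partial i (fun x => f x * g x) =
  (fun x => f x * partial i g x + g x * partial i f x).
Proof.
by move=> pf pg; apply/funext => x; apply: deriveM; exact: polyfun_derivable.
Qed.

Lemma partial_coordM i j f : polyfun f ->
  partial i (fun x => x ord0 j * f x) =
  (fun x => x ord0 j * partial i f x + (i == j)%:R * f x).
Proof.
move=> pf; rewrite (partialM _ (polyfun_coord j) pf) partial_coord.
by apply/funext => x; rewrite (mulrC (f x)).
Qed.

Lemma partialZ i a f : polyfun f ->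
  partial i (fun x => a * f x) = (fun x => a * partial i f x).
Proof.
move=> pf; rewrite (partialM _ (polyfun_cst a) pf) partial_cst.
by apply/funext => x; rewrite mulr0 addr0.
Qed.

Lemma partialB i f g : polyfun f -> polyfun g ->
  partial i (fun x => f x - g x) = (fun x => partial i f x - partial i g x).
Proof.
move=> pf pg; rewrite (partialD _ pf (polyfunN pg)).
have -> : (fun x => - g x) = (fun x => -1 * g x).
  by apply/funext => x; rewrite mulN1r.
by rewrite (partialZ _ _ pg); apply/funext => x; rewrite mulN1r.
Qed.

Lemma polyfun_partial i f : polyfun f -> polyfun (partial i f).
Proof.
elim=> [a|f1 f2 p1 IH1 p2 IH2|j f1 p1 IH1].
- by rewrite partial_cst; exact: polyfun_cst.
- by rewrite (partialD _ p1 p2); exact: polyfunD.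
- by rewrite (partial_coordM _ _ p1); apply: polyfunD;
    [exact: polyfun_coordM|exact: polyfunZ].
Qed.

Lemma polyfun_Ck U k f : polyfun f -> Ck U k f.
Proof.
elim: k f => [|k IH] f pf; (split; first by move=> x _; exact: polyfun_continuous).
  by [].
by move=> i; split=> [x _|]; [exact: polyfun_derivable|exact/IH/polyfun_partial].
Qed.

Lemma polyfun_smooth f : polyfun f -> smooth f.
Proof. by move=> pf k; exact: polyfun_Ck. Qed.

Lemma partialC i j f : polyfun f ->
  partial i (partial j f) = partial j (partial i f).
Proof.
elim=> [a|f1 f2 p1 IH1 p2 IH2|k f1 p1 IH1].
- by rewrite !partial_cst.
- have [q1 q2] := (polyfun_partial i p1, polyfun_partial j p1).
  have [q3 q4] := (polyfun_partial i p2, polyfun_partial j p2).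
  rewrite (partialD _ p1 p2) (partialD _ q2 q4).
  by rewrite (partialD _ p1 p2) (partialD _ q1 q3) IH1 IH2.
- rewrite (partial_coordM i k p1) (partial_coordM j k p1).
  have [q1 q2] := (polyfun_partial i p1, polyfun_partial j p1).
  rewrite (partialD _ (polyfun_coordM _ q2) (polyfunZ _ p1)).
  rewrite (partialD _ (polyfun_coordM _ q1) (polyfunZ _ p1)).
  rewrite (partial_coordM _ _ q1) (partial_coordM _ _ q2) !(partialZ _ _ p1) IH1.
  by apply/funext => x; ring.
Qed.

Lemma laplacian_cst a : laplacian (fun=> a) = (fun=> 0 : R) :> (E -> R).
Proof.
by apply/funext => x; rewrite /laplacian big1// => i _; rewrite !partial_cst.
Qed.

Lemma laplacianD f g x : polyfun f -> polyfun g ->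
  laplacian (fun x => f x + g x) x = laplacian f x + laplacian g x.
Proof.
move=> pf pg; rewrite /laplacian -big_split; apply: eq_bigr => i _ /=.
by rewrite (partialD _ pf pg) (partialD _ (polyfun_partial i pf) (polyfun_partial i pg)).
Qed.

Lemma laplacianZ a f x : polyfun f ->
  laplacian (fun x => a * f x) x = a * laplacian f x.
Proof.
move=> pf; rewrite /laplacian mulr_sumr; apply: eq_bigr => i _ /=.
by rewrite (partialZ _ _ pf) (partialZ _ _ (polyfun_partial i pf)).
Qed.

Lemma laplacianB f g x : polyfun f -> polyfun g ->
  laplacian (fun x => f x - g x) x = laplacian f x - laplacian g x.
Proof.
move=> pf pg; have -> : (fun x => f x - g x) = (fun x => f x + -1 * g x).
  by apply/funext => z; rewrite mulN1r.
by rewrite (laplacianD _ pf (polyfunZ (-1) pg)) (laplacianZ _ _ pg) mulN1r.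
Qed.

Lemma laplacian_coordM j f x : polyfun f ->
  laplacian (fun x => x ord0 j * f x) x =
  x ord0 j * laplacian f x + 2 * partial j f x.
Proof.
move=> pf; rewrite /laplacian.
under eq_bigr => i _.
  have pif := polyfun_partial i pf.
  rewrite (partial_coordM _ _ pf) (partialD _ (polyfun_coordM _ pif) (polyfunZ _ pf)).
  rewrite (partial_coordM _ _ pif) (partialZ _ _ pf) -addrA -mulrDl -mulr2n.
  over.
rewrite big_split -mulr_sumr /=; congr (_ + _).
rewrite (bigD1 j)//= eqxx big1 ?addr0 => [|i /negPf ->]; first by [].
by rewrite mul0rn mul0r.
Qed.

Lemma laplacian_coord j x : laplacian (fun x => x ord0 j) x = 0.
Proof.
have -> : (fun x : E => x ord0 j) = (fun x => x ord0 j * 1).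
  by apply/funext => z; rewrite mulr1.
rewrite (laplacian_coordM _ _ (polyfun_cst 1)) laplacian_cst partial_cst.
by rewrite !mulr0 addr0.
Qed.

Lemma partial_sum i (I : Type) (r : seq I) (F : I -> E -> R) :
  (forall k, polyfun (F k)) ->
  partial i (fun x => \sum_(k <- r) F k x) =
  (fun x => \sum_(k <- r) partial i (F k) x).
Proof.
move=> pF; elim: r => [|k r IH].
  rewrite (_ : (fun x => _) = (fun=> 0)) ?partial_cst; last first.
    by apply/funext => x; rewrite big_nil.
  by apply/funext => x; rewrite big_nil.
rewrite (_ : (fun x => _) = (fun x => F k x + \sum_(l <- r) F l x)); last first.
  by apply/funext => x; rewrite big_cons.
rewrite (partialD _ (pF k) (polyfun_sum r pF)) IH.
by apply/funext => x; rewrite big_cons.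
Qed.

Lemma laplacian_sum (I : Type) (r : seq I) (F : I -> E -> R) x :
  (forall k, polyfun (F k)) ->
  laplacian (fun x => \sum_(k <- r) F k x) x = \sum_(k <- r) laplacian (F k) x.
Proof.
move=> pF; rewrite /laplacian exchange_big /=; apply: eq_bigr => i _.
rewrite (partial_sum _ _ pF) (partial_sum _ _ (F := fun k => partial i (F k)))// => k.
exact: polyfun_partial.
Qed.

Lemma partial_mirror i f x : polyfun f ->
  partial i (f \o mirror) x =
  (if i == ord0 then -1 else 1) * partial i f (mirror x).
Proof.
move=> pf; elim: pf x => [a|f1 f2 p1 IH1 p2 IH2|j f1 p1 IH1] x.
- by rewrite /comp !partial_cst mulr0.
- rewrite [_ \o _](_ : _ = fun x => (f1 \o mirror) x + (f2 \o mirror) x)//.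
  rewrite (partialD _ (polyfun_mirror p1) (polyfun_mirror p2)).
  by rewrite (partialD _ p1 p2) IH1 IH2 mulrDr.
- set b : R := (if j == ord0 then -1 else 1).
  rewrite [_ \o _](_ : _ = fun x => b * (x ord0 j * (f1 \o mirror) x)); last first.
    by apply/funext => z; rewrite /comp mulrA mxE /b; case: eqP; rewrite ?mulN1r ?mul1r.
  have p1r := polyfun_mirror p1.
  rewrite (partialZ _ _ (polyfun_coordM _ p1r)) (partial_coordM _ _ p1r).
  rewrite (partial_coordM _ _ p1) IH1 /= mxE.
  rewrite (_ : (if j == ord0 then _ else _) = b * x ord0 j); last first.
    by rewrite /b; case: eqP; rewrite ?mulN1r ?mul1r.
  rewrite mulrDr [RHS]mulrDr; congr (_ + _); first by ring.
  rewrite /b; have [->|_] := eqVneq i j; last by rewrite !mul0r !mulr0.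
  rewrite !mul1r.
  by [].
Qed.

Lemma laplacian_mirror f x : polyfun f ->
  laplacian (f \o mirror) x = laplacian f (mirror x).
Proof.
move=> pf; apply: eq_bigr => i _.
set b : R := (if i == ord0 then -1 else 1).
have pif := polyfun_partial i pf.
rewrite (_ : partial i (f \o mirror) = (fun x => b * (partial i f \o mirror) x)).
  rewrite (partialZ _ _ (polyfun_mirror pif)) (partial_mirror _ _ pif) mulrA.
  by rewrite -/b (_ : b * b = 1) ?mul1r// /b; case: eqP => _; ring.
by apply/funext => z; rewrite partial_mirror.
Qed.

Lemma derive_shift (f : E -> R) c v x :
  'D_v (fun x => f (x - c)) x = 'D_v f (x - c).
Proof. by rewrite /derive; under eq_fun do rewrite /= -addrA. Qed.

Lemma partial_shift i f c x : partial i (fun x => f (x - c)) x = partial i f (x - c).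
Proof. exact: derive_shift. Qed.

Lemma laplacian_shift f c x : laplacian (fun x => f (x - c)) x = laplacian f (x - c).
Proof.
apply: eq_bigr => i _.
by rewrite -partial_shift; congr (partial i _ x); apply/funext => z; rewrite partial_shift.
Qed.

Definition sqn (x : E) : R := \sum_i (x ord0 i) ^+ 2.

Lemma sqnE x : sqn x = \sum_i x ord0 i * (x ord0 i * 1).
Proof. by apply: eq_bigr => i _; rewrite mulr1. Qed.

Lemma polyfun_sqn : polyfun sqn.
Proof.
rewrite (_ : sqn = fun x => \sum_i x ord0 i * (x ord0 i * 1)).
  by apply: polyfun_sum => i; exact/polyfun_coordM/polyfun_coordM/polyfun_cst.
by apply/funext => x; rewrite sqnE.
Qed.

Lemma laplacian_sqnM f x : polyfun f ->
  laplacian (fun x => sqn x * f x) x =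
  sqn x * laplacian f x + 4 * (\sum_i x ord0 i * partial i f x)
  + 2 * n.+1%:R * f x.
Proof.
move=> pf.
rewrite (_ : (fun x => _) = (fun x => \sum_i x ord0 i * (x ord0 i * f x))); last first.
  by apply/funext => z; rewrite mulr_suml; apply: eq_bigr => i _; rewrite expr2 mulrA.
rewrite (laplacian_sum _ _ (F := fun i x => x ord0 i * (x ord0 i * f x))); last first.
  by move=> i; exact/polyfun_coordM/polyfun_coordM.
under eq_bigr => i _.
  rewrite (laplacian_coordM _ _ (polyfun_coordM _ pf)) (laplacian_coordM _ _ pf).
  rewrite (partial_coordM _ _ pf) eqxx mul1r.
  rewrite (_ : _ + _ = x ord0 i ^+ 2 * laplacian f x
    + 4 * (x ord0 i * partial i f x) + 2 * f x); last by ring.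
  over.
rewrite !big_split /= -mulr_suml -mulr_sumr sumr_const card_ord.
by rewrite -mulr_natr; congr (_ + _); ring.
Qed.

Lemma laplacian_sqn x : laplacian sqn x = 2 * n.+1%:R.
Proof.
rewrite [X in laplacian X](_ : sqn = fun x => sqn x * 1); last first.
  by apply/funext => z; rewrite mulr1.
rewrite (laplacian_sqnM _ (polyfun_cst 1)) laplacian_cst mulr0 add0r mulr1.
by rewrite big1 ?mulr0 ?add0r// => i _; rewrite partial_cst mulr0.
Qed.

Lemma partial_sqn i x : partial i sqn x = 2 * x ord0 i.
Proof.
rewrite (_ : sqn = fun x => \sum_i x ord0 i * (x ord0 i * 1)); last first.
  by apply/funext => z; rewrite sqnE.
rewrite (partial_sum _ _ (F := fun i x => x ord0 i * (x ord0 i * 1))); last first.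
  by move=> j; exact/polyfun_coordM/polyfun_coordM/polyfun_cst.
under eq_bigr => j _.
  rewrite (partial_coordM _ _ (polyfun_coordM _ (polyfun_cst 1))).
  rewrite (partial_coordM _ _ (polyfun_cst 1)) partial_cst mulr0 add0r !mulr1.
  over.
rewrite (bigD1 i)//= big1 => [|j ji]; first by rewrite eqxx /=; ring.
by rewrite eq_sym (negPf ji) mulr0 mul0r addr0.
Qed.

End PolynomialFunctions.

(** * Harmonic polynomials and the Dirichlet problem on spheres *)

Section HarmonicPolynomials.
Context {R : realType} {n : nat}.
Local Notation E := 'rV[R]_n.+1.
Implicit Types (f g h : E -> R) (x y s c : E) (i j : 'I_n.+1).

(** The degree is an index because the Euler identity [euler] needs it. It is not determined by the
    function: zero has every degree ([homog_zero]). *)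
Inductive homog : nat -> (E -> R) -> Prop :=
| homog_cst a : homog 0 (fun=> a)
| homogD m f g : homog m f -> homog m g -> homog m (fun x => f x + g x)
| homog_coordM m i f : homog m f -> homog m.+1 (fun x => x ord0 i * f x).

Lemma homog_polyfun m f : homog m f -> polyfun f.
Proof.
elim=> [a|m' f1 f2 _ IH1 _ IH2|m' i f1 _ IH1]; first exact: polyfun_cst.
  exact: polyfunD.
exact: polyfun_coordM.
Qed.

Lemma homog0_cst f : homog 0 f -> exists a, f = fun=> a.
Proof.
have H m g : homog m g -> m = 0%N -> exists a, g = fun=> a.
  elim=> [a _|m' f1 f2 _ IH1 _ IH2 m0|//]; first by exists a.
  have [[a ->] [b ->]] := (IH1 m0, IH2 m0).
  by exists (a + b).
by move=> /H; exact.
Qed.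

Lemma homogZ m a f : homog m f -> homog m (fun x => a * f x).
Proof.
elim=> [b|m' f1 f2 _ IH1 _ IH2|m' i f1 _ IH1]; first exact: homog_cst.
  rewrite (_ : (fun x => _) = (fun x => a * f1 x + a * f2 x)).
    exact: homogD.
  by apply/funext => x; rewrite mulrDr.
rewrite (_ : (fun x => _) = (fun x => x ord0 i * (a * f1 x))).
  exact: homog_coordM.
by apply/funext => x; rewrite mulrCA.
Qed.

Lemma homog_zero m : homog m (fun=> 0).
Proof.
elim: m => [|m IH]; first exact: homog_cst.
rewrite (_ : (fun=> _) = (fun x => x ord0 ord0 * 0)); first exact: homog_coordM.
by apply/funext => x; rewrite mulr0.
Qed.

Lemma homog_sqnM m f : homog m f -> homog m.+2 (fun x => sqn x * f x).
Proof.
move=> hf; rewrite (_ : (fun x => _) =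
    (fun x => \sum_i x ord0 i * (x ord0 i * f x))); last first.
  by apply/funext => x; rewrite mulr_suml; apply: eq_bigr => i _; rewrite expr2 mulrA.
elim: (index_enum _) => [|i r IH].
  rewrite (_ : (fun x => _) = (fun=> 0)); first exact: homog_zero.
  by apply/funext => x; rewrite big_nil.
rewrite (_ : (fun x => _) = (fun x => x ord0 i * (x ord0 i * f x) +
    \sum_(i <- r) x ord0 i * (x ord0 i * f x))); last first.
  by apply/funext => x; rewrite big_cons.
by apply: homogD => //; exact/homog_coordM/homog_coordM.
Qed.

Lemma homog_partial m i f : homog m f -> homog m.-1 (partial i f).
Proof.
elim=> [a|m' f1 f2 h1 IH1 h2 IH2|m' j f1 h1 IH1].
- by rewrite partial_cst; exact: homog_cst.
- by rewrite (partialD _ (homog_polyfun h1) (homog_polyfun h2)); exact: homogD.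
- rewrite (partial_coordM _ _ (homog_polyfun h1)).
  (* In degree 0 the predecessor is 0 again, so the degree of the product with a coordinate would be
     off by one; there the derivative vanishes instead. *)
  case: m' h1 IH1 => [|m'] h1 IH1 /=.
    have [a ->] := homog0_cst h1; rewrite partial_cst.
    by under eq_fun do rewrite mulr0 add0r; exact: homog_cst.
  by apply: homogD; [exact: homog_coordM|exact: homogZ].
Qed.

Lemma euler m f x : homog m f ->
  \sum_i x ord0 i * partial i f x = m%:R * f x.
Proof.
move=> hf; elim: hf x => [a|m' f1 f2 h1 IH1 h2 IH2|m' j f1 h1 IH1] x.
- by rewrite mul0r big1// => i _; rewrite partial_cst mulr0.
- rewrite mulrDr -IH1 -IH2 -big_split; apply: eq_bigr => i _.
  by rewrite (partialD _ (homog_polyfun h1) (homog_polyfun h2)) mulrDr.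
- rewrite -natr1 mulrDl mul1r mulrCA -IH1 mulr_sumr.
  under eq_bigr do rewrite (partial_coordM _ _ (homog_polyfun h1)) mulrDr.
  rewrite big_split /=; congr (_ + _).
    by apply: eq_bigr => i _; rewrite mulrCA.
  rewrite (bigD1 j)//= eqxx big1 ?addr0 ?mul1r// => i /negPf ->.
  by rewrite mul0r mulr0.
Qed.

Lemma laplacian_partial i f : polyfun f ->
  laplacian (partial i f) = partial i (laplacian f).
Proof.
move=> pf; apply/funext => x; rewrite /laplacian.
rewrite (partial_sum _ _ (F := fun j => partial j (partial j f))); last first.
  by move=> j; exact/polyfun_partial/polyfun_partial.
apply: eq_bigr => j _.
by rewrite (partialC j i pf) (partialC j i (polyfun_partial j pf)).
Qed.

(** Sums of homogeneous harmonic pieces, rather than polynomials with zero Laplacian, so that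
    [harmpoly_coordM] can correct each piece according to its degree. *)
Inductive harmpoly : (E -> R) -> Prop :=
| harmpoly_homog m f : homog m f -> (forall x, laplacian f x = 0) -> harmpoly f
| harmpolyD f g : harmpoly f -> harmpoly g -> harmpoly (fun x => f x + g x).

Lemma harmpoly_polyfun f : harmpoly f -> polyfun f.
Proof.
by elim=> [m g /homog_polyfun//|f1 f2 _ IH1 _ IH2]; exact: polyfunD.
Qed.

Lemma harmpoly_laplacian f x : harmpoly f -> laplacian f x = 0.
Proof.
elim=> [m g _ ->//|f1 f2 h1 IH1 h2 IH2].
by rewrite (laplacianD _ (harmpoly_polyfun h1) (harmpoly_polyfun h2)) IH1 IH2 addr0.
Qed.

(* [x_i h - |x|^2 k] with [k] a multiple of [partial i h] is harmonic by the
   Euler identity, and [|x|^2 k] agrees with the harmonic [q k] on the sphere. *)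
Lemma harmpoly_coordM i q h : harmpoly h ->
  exists2 h', harmpoly h' & forall x, sqn x = q -> h' x = x ord0 i * h x.
Proof.
elim=> [m f hf lf|f1 f2 _ [h1 hh1 e1] _ [h2 hh2 e2]]; last first.
  exists (fun x => h1 x + h2 x); first exact: harmpolyD.
  by move=> x xq; rewrite e1// e2// mulrDr.
have pf := homog_polyfun hf.
case: m hf => [|m] hf.
  exists (fun x => x ord0 i * f x) => //.
  apply: (harmpoly_homog (homog_coordM i hf)) => x.
  rewrite (laplacian_coordM _ _ pf) lf.
  by have [a ->] := homog0_cst hf; rewrite partial_cst !mulr0 addr0.
(* Here [f] has degree [m.+1]. The Laplacian of [x_i f] is [2 partial i f], and that of [|x|^2 k],
   for [k] harmonic of degree [m], is [2 (d + 2 m) k] with [d = n.+1]; this [c] makes the two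
   equal. *)
pose c : R := (n.+1%:R + 2 * m%:R)^-1.
have c0 : (n.+1%:R + 2 * m%:R) * c = 1.
  by apply: mulfV; rewrite -natrM -natrD pnatr_eq0 addSn.
pose k x := c * partial i f x.
have pif := polyfun_partial i pf.
have hk : homog m k by exact/homogZ/(homog_partial i hf).
have lk x : laplacian k x = 0.
  rewrite (laplacianZ _ _ pif) (laplacian_partial i pf).
  rewrite (_ : laplacian f = fun=> 0) ?partial_cst ?mulr0//.
  exact/funext.
exists (fun x => (x ord0 i * f x + -1 * (sqn x * k x)) + q * k x); last first.
  by move=> x ->; rewrite mulN1r subrK.
have pk := homog_polyfun hk.
have psk := polyfunM polyfun_sqn pk.
apply: harmpolyD; last first.
  by apply: (harmpoly_homog (homogZ q hk)) => x; rewrite (laplacianZ _ _ pk) lk mulr0.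
apply: (@harmpoly_homog m.+2) => [|x].
  by apply: homogD; [exact: homog_coordM|exact/homogZ/homog_sqnM].
rewrite (laplacianD _ (polyfun_coordM i pf) (polyfunZ (-1) psk)).
rewrite (laplacianZ _ _ psk) (laplacian_coordM _ _ pf) (laplacian_sqnM _ pk).
rewrite lf lk (euler _ hk) !mulr0 !add0r /k.
transitivity (2 * partial i f x * (1 - (n.+1%:R + 2 * m%:R) * c)); first by ring.
by rewrite c0 subrr mulr0.
Qed.

(** Along the construction of [f], each factor is replaced by its harmonic substitute before it is
    multiplied by a coordinate. This does the work of a Poisson integral. *)
Lemma dirichlet_sphere q f : polyfun f ->
  exists2 h, harmpoly h & forall x, sqn x = q -> h x = f x.
Proof.
elim=> [a|f1 f2 _ [h1 hh1 e1] _ [h2 hh2 e2]|i f1 _ [h1 hh1 e1]].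
- exists (fun=> a) => //; apply: (harmpoly_homog (homog_cst a)) => x.
  by rewrite laplacian_cst.
- exists (fun x => h1 x + h2 x); first exact: harmpolyD.
  by move=> x xq; rewrite e1// e2.
- have [h2 hh2 e2] := harmpoly_coordM i q hh1.
  by exists h2 => // x xq; rewrite e2// e1.
Qed.

End HarmonicPolynomials.

(** * Polynomial approximation *)

Section Approximation.
Context {R : realType} {n : nat}.
Local Notation E := 'rV[R]_n.+1.
Implicit Types (f g : E -> R) (x y z c : E) (i j : 'I_n.+1).

Lemma coord_le_norm x i : `|x ord0 i| <= `|x|.
Proof.
by rewrite [leRHS]/Num.norm /= mx_normrE; apply/bigmax_geP; right => /=; exists (ord0, i).
Qed.

Lemma sqn_ge0 x : 0 <= sqn x.
Proof. by apply: sumr_ge0 => i _; exact: sqr_ge0. Qed.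

Lemma sqn0 : sqn (0 : E) = 0.
Proof. by rewrite /sqn big1// => i _; rewrite mxE expr0n. Qed.

Lemma sqnN x : sqn (- x) = sqn x.
Proof. by apply: eq_bigr => i _; rewrite mxE sqrrN. Qed.

Lemma sqnZ a x : sqn (a *: x) = a ^+ 2 * sqn x.
Proof. by rewrite mulr_sumr; apply: eq_bigr => i _; rewrite mxE exprMn. Qed.

Lemma coord_sqn x i : (x ord0 i) ^+ 2 <= sqn x.
Proof.
rewrite /sqn (bigD1 i)//= lerDl; apply: sumr_ge0 => j _; exact: sqr_ge0.
Qed.

Lemma norm_sqr_le_sqn x : `|x| ^+ 2 <= sqn x.
Proof.
have [/mx_norm_eq0 ->|/mx_norm_neq0[[i j] xij]] := eqVneq (mx_norm x) 0.
  by rewrite normr0 expr0n sqn_ge0.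
rewrite [X in X ^+ 2](_ : _ = `|x i j|)//.
by rewrite real_normK ?num_real// (ord1 i) coord_sqn.
Qed.

Lemma sqn_le_norm x : sqn x <= n.+1%:R * `|x| ^+ 2.
Proof.
have -> : n.+1%:R * `|x| ^+ 2 = \sum_(i < n.+1) `|x| ^+ 2.
  by rewrite sumr_const card_ord mulr_natl.
apply: ler_sum => i _; rewrite -(real_normK (num_real (x ord0 i))).
by rewrite lerXn2r ?nnegrE ?coord_le_norm.
Qed.

Lemma sqnD x y : sqn (x + y) = sqn x + 2 * (\sum_i x ord0 i * y ord0 i) + sqn y.
Proof.
rewrite /sqn mulr_sumr -!big_split; apply: eq_bigr => i _ /=.
by rewrite mxE; ring.
Qed.

Lemma sqnD_basis x a i : sqn (x + a *: basis_vec i) = sqn x + 2 * a * x ord0 i + a ^+ 2.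
Proof.
rewrite sqnD sqnZ; congr (_ + _ + _).
  rewrite (bigD1 i)//= big1 ?addr0; last first.
    by move=> j ji; rewrite !mxE eqxx (negPf ji) !mulr0.
  by rewrite !mxE !eqxx /=; ring.
rewrite /sqn (bigD1 i)//= big1 ?addr0; last first.
  by move=> j ji; rewrite !mxE eqxx (negPf ji) expr0n.
by rewrite !mxE !eqxx /= expr1n mulr1.
Qed.

Let dim : R := n.+1%:R.

(** The uniform weight [1 / (2 d)], tilted affinely in [x]: affinity makes every expectation a
    polynomial in [x], and the sign of [a] selects the direction of the step. *)
Definition walk_prob (a : R) (i : 'I_n.+1) (x : E) : R :=
  (2 * dim)^-1 * (1 + dim / a * x ord0 i).

(* The expectation of [f] after [k] steps of the random walk from [z] that
   moves by [h e_i] or [- h e_i] with probability [walk_prob a i x] or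
   [walk_prob (- a) i x]; one step has mean [(h / a) x], so that [a / h] steps
   from the origin end up near [x]. *)
Fixpoint walk (a h : R) (f : E -> R) (k : nat) (z x : E) : R :=
  if k is k'.+1 then
    \sum_i (walk_prob a i x * walk a h f k' (z + h *: basis_vec i) x +
            walk_prob (- a) i x * walk a h f k' (z + (- h) *: basis_vec i) x)
  else f z.

Lemma polyfun_walk a h f k z : polyfun (walk a h f k z).
Proof.
elim: k z => [|k IH] z /=; first exact: polyfun_cst.
have pp b i : polyfun (walk_prob b i).
  apply: polyfunZ; apply: polyfunD; first exact: polyfun_cst.
  exact/polyfunZ/polyfun_coord.
by apply: polyfun_sum => i; apply: polyfunD; exact: polyfunM.
Qed.

Lemma walk_prob_ge0 (a : R) i x : `|x ord0 i| <= `|a| / dim -> 0 <= walk_prob a i x.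
Proof.
have d0 : 0 < dim by rewrite ltr0n.
move=> xa; rewrite /walk_prob; apply: mulr_ge0; first by rewrite invr_ge0 mulr_ge0// ltW.
have [->|a0] := eqVneq a 0; first by rewrite invr0 mulr0 mul0r addr0.
rewrite -lerBlDl sub0r lerNl (le_trans (ler_norm _))//.
rewrite normrN !normrM normfV (gtr0_norm d0).
rewrite ler_pdivlMr// in xa.
by rewrite mulrAC mulrC ler_pdivrMl ?normr_gt0// mulr1 mulrC.
Qed.

(** A second moment estimate: after [k] steps the squared bias is [sqn (z + (k h / a) x - x)] and
    the variance is at most [k h^2]. The induction conditions on the first step. *)
Lemma walk_approx (a h : R) f x (c0 al be : R) k z : 0 < a ->
  (forall i, `|x ord0 i| <= a / dim) ->
  0 <= be ->
  (forall y, `|f y - c0| <= al + be * sqn (y - x)) ->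
  `|walk a h f k z x - c0| <=
    al + be * (sqn (z + (k%:R * h / a) *: x - x) + k%:R * h ^+ 2).
Proof.
move=> a0 xa be0 fc; have d0 : 0 < dim by rewrite ltr0n.
have an0 : a != 0 by rewrite gt_eqF.
have dn0 : dim != 0 by rewrite gt_eqF.
elim: k z => [|k IH] z /=; first by rewrite !mul0r scale0r !addr0.
pose p i := walk_prob a i x; pose q i := walk_prob (- a) i x.
have p0 i : 0 <= p i by apply: walk_prob_ge0; rewrite (gtr0_norm a0).
have q0 i : 0 <= q i by apply: walk_prob_ge0; rewrite normrN (gtr0_norm a0).
have pq i : p i + q i = dim^-1.
  by rewrite /p /q /walk_prob; field; rewrite ?nat1r ?an0 ?dn0.
have pmq i : p i - q i = x ord0 i / a.
  by rewrite /p /q /walk_prob; field; rewrite ?nat1r ?an0 ?dn0.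
have sumpq (c1 : R) : \sum_i (p i + q i) * c1 = c1.
  under eq_bigr do rewrite pq.
  by rewrite sumr_const card_ord -mulr_natl mulVKf.
rewrite -[X in _ - X](sumpq c0) -sumrB.
pose w := z + (k%:R * h / a) *: x - x.
pose be1 := al + be * (k%:R * h ^+ 2).
apply: (le_trans (ler_norm_sum _ _ _)).
apply: (@le_trans _ _ (\sum_i (p i * (be1 + be * (sqn w + 2 * h * w ord0 i + h ^+ 2))
   + q i * (be1 + be * (sqn w - 2 * h * w ord0 i + h ^+ 2))))).
  apply: ler_sum => i _.
  rewrite (_ : _ - _ = p i * (walk a h f k (z + h *: basis_vec i) x - c0)
     + q i * (walk a h f k (z + (- h) *: basis_vec i) x - c0)); last first.
    by rewrite /p /q; ring.
  apply: (le_trans (ler_normD _ _)).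
  rewrite normrM [X in _ + X]normrM (ger0_norm (p0 i)) (ger0_norm (q0 i)).
  apply: lerD; apply: ler_wpM2l => //.
    apply: (le_trans (IH _)); rewrite le_eqVlt; apply/orP; left; apply/eqP.
    rewrite -sqnD_basis (_ : _ + _ - x = w + h *: basis_vec i).
      by rewrite /be1; ring.
    by apply/rowP => j; rewrite !mxE; ring.
  apply: (le_trans (IH _)); rewrite le_eqVlt; apply/orP; left; apply/eqP.
  rewrite (_ : _ + h ^+ 2 = sqn (w + (- h) *: basis_vec i)).
    rewrite (_ : _ + _ - x = w + (- h) *: basis_vec i); first by rewrite /be1; ring.
    by apply/rowP => j; rewrite !mxE; ring.
  by rewrite sqnD_basis; ring.
rewrite (_ : \sum_i _ = \sum_i (p i + q i) * (be1 + be * (sqn w + h ^+ 2))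
    + be * (2 * (h / a) * \sum_i w ord0 i * x ord0 i)); last first.
  rewrite !mulr_sumr -big_split; apply: eq_bigr => i _ /=.
  transitivity ((p i + q i) * (be1 + be * (sqn w + h ^+ 2)) +
    be * (2 * h * (w ord0 i * (p i - q i)))); first by ring.
  by rewrite pmq; ring.
rewrite sumpq /be1 -addrA -addrA lerD2l -!mulrDr ler_wpM2l//.
rewrite (_ : z + _ - x = w + (h / a) *: x); last first.
  by rewrite /w -natr1; apply/rowP => j; rewrite !mxE; ring.
rewrite sqnD sqnZ -natr1; move: w => w.
have -> : 2 * (\sum_i w ord0 i * ((h / a) *: x) ord0 i) =
   2 * (h / a) * (\sum_i w ord0 i * x ord0 i).
  by rewrite !mulr_sumr; apply: eq_bigr => i _; rewrite mxE; ring.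
(* The squared drift [(h / a)^2 |x|^2], by which the variance of a step falls short of [h^2], is
   discarded. *)
have := mulr_ge0 (sqr_ge0 (h / a)) (sqn_ge0 x).
by set T1 := (h / a) ^+ 2 * _; set T2 := 2 * _ * _; move: T1 T2 => T1 T2; lra.
Qed.

Lemma lipschitz_polyfun_approx f (L b ga : R) : 0 <= L -> 0 < b -> 0 < ga ->
  (forall x y, `|f x - f y| <= L * `|x - y|) ->
  exists2 P, polyfun P & forall x, `|x| <= b -> `|P x - f x| <= ga.
Proof.
move=> L0 b0 ga0 fL; have d0 : 0 < dim by rewrite ltr0n.
(* This [a] keeps the walk probabilities nonnegative for [|x| <= b]. By [t <= e + t^2 / e] the
   Lipschitz bound becomes quadratic; [e] makes the constant part at most [ga / 2], and [N] does the
   same for the variance part, since [N h^2 = a^2 / N]. *)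
pose a := dim * b; have a0 : 0 < a by exact: mulr_gt0.
pose e := ga / (2 * (L + 1)); have e0 : 0 < e by rewrite divr_gt0// mulr_gt0// ltr_wpDl.
pose N := (Num.truncn (2 * (L / e) * a ^+ 2 / ga)).+1.
have N0 : 0 < N%:R :> R by rewrite ltr0n.
pose h := a / N%:R.
exists (walk a h f N 0) => [|x xb]; first exact: polyfun_walk.
have fx y : `|f y - f x| <= L * e + L / e * sqn (y - x).
  apply: (le_trans (fL _ _)); rewrite -mulrA -mulrDr ler_wpM2l//.
  have le1 : `|y - x| ^+ 2 <= sqn (y - x) := norm_sqr_le_sqn _.
  set t := `|y - x| in le1 *.
  have : 0 <= (e - t) ^+ 2 by exact: sqr_ge0.
  have t0 : 0 <= t by exact: normr_ge0.
  move=> sq; rewrite -(ler_pM2l e0) mulrDr [X in _ + X]mulrA mulfV ?gt_eqF// mul1r.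
  move: sq; rewrite sqrrB -mulr_natl; nra.
have xa i : `|x ord0 i| <= a / dim.
  by rewrite /a mulrAC mulfV ?gt_eqF// mul1r (le_trans (coord_le_norm _ _)).
apply: (le_trans (walk_approx h N 0 a0 xa _ fx)); first by rewrite divr_ge0// ltW.
rewrite add0r (_ : N%:R * h / a = 1); last by rewrite /h; field; rewrite !gt_eqF.
rewrite scale1r subrr sqn0 add0r.
have Le : L * e <= ga / 2.
  rewrite /e mulrA ler_pdivrMr; last by rewrite mulr_gt0// ltr_wpDl.
  by rewrite (_ : ga / 2 * _ = L * ga + ga); [rewrite lerDl ltW|field].
have NN : 2 * (L / e) * a ^+ 2 / ga < N%:R by exact: truncnS_gt.
have : L / e * (N%:R * h ^+ 2) <= ga / 2.
  rewrite (_ : N%:R * h ^+ 2 = a ^+ 2 / N%:R); last by rewrite /h; field; rewrite gt_eqF.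
  rewrite mulrA ler_pdivrMr//.
  move/ltW: NN; rewrite ler_pdivrMr//; lra.
lra.
Qed.

End Approximation.

(** * Semicontinuous functions and insertion *)

Section UpperSemicontinuity.
Context {R : realType} {T : topologicalType}.
Implicit Types (A B : set T) (f g : T -> R).

Definition usc A f := forall x, A x -> forall c, f x < c ->
  \forall y \near x, A y -> f y < c.

Lemma usc_sub A B f : B `<=` A -> usc A f -> usc B f.
Proof.
move=> BA fA x Bx c fxc; have := fA x (BA x Bx) c fxc.
by apply: filterS => y + By; apply; exact: BA.
Qed.

Lemma continuous_usc A f : continuous f -> usc A f.
Proof.
move=> cf x Ax c fxc; have H : \forall y \near x, f y < c by exact: (cvgr_lt (f x) (cf x)).
by apply: filterS H.
Qed.

Lemma uscD A f g : usc A f -> usc A g -> usc A (fun x => f x + g x).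
Proof.
move=> fA gA x Ax c fgc; pose e := (c - f x - g x) / 2.
have e0 : 0 < e by rewrite /e; lra.
have := fA x Ax (f x + e); rewrite ltrDl e0 => /(_ isT) nf.
have := gA x Ax (g x + e); rewrite ltrDl e0 => /(_ isT) ng.
apply: filterS2 nf ng => y fy gy Ay.
by move: (fy Ay) (gy Ay); rewrite /e; lra.
Qed.

(** Without a maximum, every point has a neighborhood where [f] stays below some value of [f].
    Compactness, used along the filter of upper level sets, then gives a value of [f] that exceeds
    all values on [A], itself included. *)
Lemma usc_max A f : compact A -> A !=set0 -> usc A f ->
  exists2 x, A x & forall y, A y -> f y <= f x.
Proof.
move=> /compact_near_coveringP cA [a Aa] fA; apply: contrapT => nomax.
have above x : A x -> exists2 y, A y & f x < f y.
  move=> Ax; apply: contrapT => nabove; apply: nomax; exists x => // y Ay.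
  by rewrite leNgt; apply/negP => fxy; apply: nabove; exists y.
pose F : set_system T :=
  [set Q | exists2 x0, A x0 & forall i, A i -> f x0 <= f i -> Q i].
have FF : Filter F.
  split=> [|P Q [p Ap Pp] [q Aq Qq]|P Q PQ [p Ap Pp]].
  - by exists a.
  - have [fpq|/ltW fqp] := leP (f p) (f q).
      by exists q => // i Ai fi; split; [apply: Pp => //; exact: le_trans fi|exact: Qq].
    by exists p => // i Ai fi; split; [exact: Pp|apply: Qq => //; exact: le_trans fi].
  - by exists p => // i Ai fi; exact/PQ/Pp.
have := cA T F (fun i x => A x -> f x < f i) FF.
case=> [x Ax|x0 Ax0 H].
  have [y Ay fxy] := above x Ax.
  exists ([set x' | A x' -> f x' < f y], [set i | f y <= f i]) => /=.
    by split; [exact: fA|exists y].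
  by move=> [x' i] /= [Hx' fyi] Ax'; exact: lt_le_trans (Hx' Ax') fyi.
by have := H x0 Ax0 (lexx _) x0 Ax0 Ax0; rewrite ltxx.
Qed.

Lemma usc_closed_ge A f c : closed A -> usc A f ->
  closed (A `&` [set x | c <= f x]).
Proof.
move=> cA fA x clx.
have Ax : A x by apply: cA; apply: closureS clx => y [].
split=> //=; rewrite leNgt; apply/negP => /(fA x Ax) nx.
by have [y [[Ay /= cfy]]] := clx _ nx; move=> /(_ Ay); rewrite ltNge cfy.
Qed.

Lemma opp_mul_continuous (k : R) f :
  continuous f -> continuous (fun z => - (k * f z)).
Proof.
move=> cf z; have c0 : {for z, continuous (fun=> k : R)} by exact: cst_continuous.
exact: (continuousN (continuousM c0 (cf z))).
Qed.

End UpperSemicontinuity.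

Lemma usc_comp {R : realType} {T S : topologicalType} (A : set T) (B : set S)
    (f : T -> R) (g : S -> T) :
  usc A f -> continuous g -> (forall x, B x -> A (g x)) -> usc B (f \o g).
Proof.
move=> fA cg gBA x Bx c fgc.
have H : \forall y \near x, A (g y) -> f (g y) < c := cg x _ (fA _ (gBA x Bx) c fgc).
by apply: filterS H => y /= + By; apply; exact: gBA.
Qed.

Section Semicontinuity.
Context {R : realType} {n : nat}.
Local Notation E := 'rV[R]_n.+1.
Implicit Types (A S : set E) (f g : E -> R) (x y : E).

Lemma lsc_on_usc A f : lsc_on A f -> usc A (fun x => - f x).
Proof.
move=> fA x Ax c; rewrite ltrNl -lte_fin => /(fA x)[V].
move=> nV fV; have : within A (nbhs x) V by rewrite (nbhs_subspace_in Ax).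
rewrite /within /=; apply: filterS => y Vy Ay.
by have := fV y (Vy Ay); rewrite lte_fin ltrNl.
Qed.

Lemma usc_on_usc A f : usc_on A f -> usc A f.
Proof.
by move=> /lsc_on_usc; congr usc; apply/funext => x /=; rewrite opprK.
Qed.

Lemma dist_continuous x : continuous (fun z : E => `|x - z|).
Proof.
move=> z; apply: (@continuous_comp _ _ _ (fun z : E => x - z) Num.norm).
  apply: continuousB; first exact: cst_continuous.
  exact: cvg_id.
apply: norm_continuous.
Qed.

(** The function [h] is the sup-convolution [max_y (f y - k |x - y|)]. A suitable [k] exists because
    the pairs with [f y + g x >= 0] form a compact set off the diagonal, hence at a positive
    distance from it. *)
Lemma lipschitz_insertion S f g : compact S -> usc S f -> usc S g ->
  (forall x, S x -> f x + g x < 0) ->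
  exists h k ga, [/\ 0 <= k, 0 < ga,
    forall x y, `|h x - h y| <= k * `|x - y| &
    forall x, S x -> f x <= h x /\ h x <= - g x - 3 * ga].
Proof.
move=> cS fS gS fg0.
have [->|/set0P S0] := eqVneq S set0.
  by exists (fun=> 0), 0, 1; split => // x y; rewrite subrr normr0 mul0r.
have [xf Sxf fmax] := usc_max cS S0 fS.
have [xg Sxg gmax] := usc_max cS S0 gS.
have cSS : compact (S `*` S) := compact_setX cS cS.
have fS2 : usc (S `*` S) (f \o snd) by apply: (usc_comp fS) => [p|p []//]; exact: cvg_snd.
have gS1 : usc (S `*` S) (g \o fst) by apply: (usc_comp gS) => [p|p []//]; exact: cvg_fst.
have dc : continuous (fun p : E * E => `|p.1 - p.2|).
  move=> p; apply: (@cvg_norm _ _ _ _ _ (fun p : E * E => p.1 - p.2)).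
  by apply: cvgB; [exact: cvg_fst|exact: cvg_snd].
have ndc (k : R) : continuous (fun p : E * E => - (k * `|p.1 - p.2|)).
  exact: opp_mul_continuous.
have [k k0 kfg] : exists2 k, 0 <= k &
    forall x y, S x -> S y -> f y + g x - k * `|x - y| < 0.
  pose K := (S `*` S) `&` [set p | 0 <= f p.2 + g p.1].
  have Kc : compact K.
    apply: (subclosed_compact _ cSS) => [|p []//].
    apply: usc_closed_ge; first exact: (compact_closed (@norm_hausdorff _ (E * E)%type)) cSS.
    exact: (uscD fS2 gS1).
  have [K0|/set0P K0] := eqVneq K set0.
    exists 0 => // x y Sx Sy; rewrite mul0r subr0 ltNge; apply/negP => fg.
    by have : K (x, y) by []; rewrite K0.
  have [[a b] [[/= Sa Sb] fgab] dmin] := usc_max Kc K0 (continuous_usc (ndc 1)).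
  have ab0 : 0 < `|a - b|.
    rewrite normr_gt0; apply/eqP => /subr0_eq ab.
    by move: fgab; rewrite /= ab leNgt fg0.
  have k0 : 0 <= (`|f xf + g xg| + 1) / `|a - b|.
    by rewrite divr_ge0 ?addr_ge0.
  exists ((`|f xf + g xg| + 1) / `|a - b|) => // x y Sx Sy.
  have [fg|] := ltP (f y + g x) 0.
    by rewrite -[ltRHS]addr0 ltr_leD// oppr_le0 mulr_ge0.
  move=> fg; have /= := dmin (x, y) (conj (conj Sx Sy) fg).
  rewrite !mul1r lerN2 => dxy; rewrite subr_lt0.
  apply: (@lt_le_trans _ _ (`|f xf + g xg| + 1)).
    apply: (@le_lt_trans _ _ (f xf + g xg)); first by apply: lerD; [exact: fmax|exact: gmax].
    by rewrite (le_lt_trans (ler_norm _))// ltrDl.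
  by rewrite -[leLHS](mulfVK (lt0r_neq0 ab0)) ler_wpM2l.
have [[a b] [/= Sa Sb] abmax] := usc_max cSS (ex_intro _ (xf, xf) (conj Sxf Sxf))
  (uscD (uscD fS2 gS1) (continuous_usc (ndc k))).
(* A third of the least gap: [polyfun_insertion] approximates [h + 3 / 2 ga] up to [ga] and keeps
   both inequalities strict. *)
pose ga := - (f b + g a - k * `|a - b|) / 3.
have ga0 : 0 < ga by have := kfg a b Sa Sb; rewrite /ga; lra.
have /choice[m mP] : forall x, exists y, S y /\
    forall z, S z -> f z - k * `|x - z| <= f y - k * `|x - y|.
  move=> x; have cx : continuous (fun z : E => - (k * `|x - z|)).
    by apply: opp_mul_continuous; exact: dist_continuous.
  have [y Sy ymax] := usc_max cS S0 (uscD fS (continuous_usc cx)).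
  by exists y.
have main x y : f (m x) - k * `|x - m x| - (f (m y) - k * `|y - m y|)
    <= k * `|x - y|.
  have := (mP y).2 (m x) (mP x).1.
  have : k * `|y - m x| <= k * (`|x - y| + `|x - m x|).
    by rewrite ler_wpM2l// (distrC x y) -(subrKA x y) ler_normD.
  rewrite mulrDr; lra.
exists (fun x => f (m x) - k * `|x - m x|), k, ga; split => // [x y|x Sx].
  rewrite ler_norml main andbT; move: (main y x); rewrite (distrC y x); lra.
split; first by have := (mP x).2 x Sx; rewrite subrr normr0 mulr0 subr0.
have := abmax (x, m x) (conj Sx (mP x).1); rewrite /= /ga; lra.
Qed.

Lemma polyfun_insertion S f g : compact S -> usc S f -> usc S g ->
  (forall x, S x -> f x + g x < 0) ->
  exists2 P, polyfun P & forall x, S x -> f x < P x < - g x.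
Proof.
move=> cS fS gS fg; have [h [k [ga [k0 ga0 lip hfg]]]] := lipschitz_insertion cS fS gS fg.
have [b [breal bP]] := compact_bounded cS.
pose B := `|b| + 1; have B0 : 0 < B by rewrite ltr_wpDl.
have bB : b < B by rewrite (le_lt_trans (ler_norm _))// ltrDl.
have lip' x y : `|(h x + 3 / 2 * ga) - (h y + 3 / 2 * ga)| <= k * `|x - y|.
  by rewrite opprD addrACA subrr addr0.
have [P pP PP] := lipschitz_polyfun_approx k0 B0 ga0 lip'.
exists P => // x Sx; have [fh hg] := hfg x Sx.
have := PP x (bP _ bB x Sx); rewrite ler_norml => /andP[].
by move=> ? ?; apply/andP; split; lra.
Qed.

Lemma coord_continuous_fun i : continuous (fun x : E => x ord0 i).
Proof. by move=> x; exact: coord_continuous. Qed.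

Lemma sqn_continuous : continuous (@sqn R n).
Proof. exact/polyfun_continuous/polyfun_sqn. Qed.

Lemma compact_sqn_closed q A : closed A -> A `<=` [set x | sqn x <= q] -> compact A.
Proof.
move=> cA Aq; apply: bounded_closed_compact => //.
exists (q + 1); split; first exact: num_real.
move=> b qb x Ax; have := norm_sqr_le_sqn x; have := Aq x Ax => /= h1 h2.
have n0 := normr_ge0 x; have := le_trans h2 h1.
by rewrite leNgt => /negP; apply: contra_notT; rewrite -ltNge => bx; nra.
Qed.

Lemma compact_sphere q : compact [set x : E | sqn x = q].
Proof.
apply: (@compact_sqn_closed q) => [|x /= ->//].
rewrite (_ : [set x | _] = @sqn R n @^-1` [set q])//.
apply: closed_comp => [x _|]; first exact: sqn_continuous.
exact: closed_eq.
Qed.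

Lemma harmpoly_insertion q f g :
  usc [set x | sqn x = q] f -> usc [set x | sqn x = q] g ->
  (forall x, sqn x = q -> f x + g x < 0) ->
  exists2 H, harmpoly H & forall x, sqn x = q -> f x < H x < - g x.
Proof.
move=> fS gS fg; have [P pP PP] := polyfun_insertion (@compact_sphere q) fS gS fg.
have [H hH HP] := dirichlet_sphere q pP.
by exists H => // x xq; rewrite HP//; exact: PP.
Qed.

End Semicontinuity.

(** * Comparison with harmonic polynomials *)

Section Comparison.
Context {R : realType} {n : nat}.
Local Notation E := 'rV[R]_n.+1.
Implicit Types (A U : set E) (u v F G : E -> R) (x y s t c : E) (i : 'I_n.+1).

Definition dot x y : R := \sum_i x ord0 i * y ord0 i.

Lemma polyfun_dot x : polyfun (dot x).
Proof. by apply: polyfun_sum => i; exact/polyfunZ/polyfun_coord. Qed.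

Lemma laplacian_dot x y : laplacian (dot x) y = 0.
Proof.
rewrite (laplacian_sum _ _ (F := fun i z => x ord0 i * z ord0 i)) => [|i].
  by apply: big1 => i _; rewrite (laplacianZ _ _ (polyfun_coord i)) laplacian_coord mulr0.
exact/polyfunZ/polyfun_coord.
Qed.

Lemma partial_dot i x y : partial i (dot x) y = x ord0 i.
Proof.
rewrite (partial_sum _ _ (F := fun i z => x ord0 i * z ord0 i)) => [|j]; last first.
  exact/polyfunZ/polyfun_coord.
under eq_bigr do rewrite (partialZ _ _ (polyfun_coord _)) partial_coord.
by rewrite (bigD1 i)//= eqxx mulr1 big1 ?addr0// => j; rewrite eq_sym => /negPf ->; rewrite mulr0.
Qed.

Lemma dotx0 x : dot x 0 = 0.
Proof. by apply: big1 => i _; rewrite mxE mulr0. Qed.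

Lemma sqnD_dot x y : sqn (x + y) = sqn x + 2 * dot x y + sqn y.
Proof. exact: sqnD. Qed.

Definition harmonic_polyfun F := polyfun F /\ forall x, laplacian F x = 0.

Lemma harmpolyW F : harmpoly F -> harmonic_polyfun F.
Proof.
by move=> hF; split=> [|x]; [exact: harmpoly_polyfun|exact: harmpoly_laplacian].
Qed.

Lemma harmonic_polyfunD F G : harmonic_polyfun F -> harmonic_polyfun G ->
  harmonic_polyfun (fun x => F x + G x).
Proof.
move=> [pF lF] [pG lG]; split; first exact: polyfunD.
by move=> x; rewrite (laplacianD _ pF pG) lF lG addr0.
Qed.

Lemma harmonic_polyfunZ a F : harmonic_polyfun F ->
  harmonic_polyfun (fun x => a * F x).
Proof.
move=> [pF lF]; split; first exact: polyfunZ.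
by move=> x; rewrite (laplacianZ _ _ pF) lF mulr0.
Qed.

Lemma harmonic_polyfunB F G : harmonic_polyfun F -> harmonic_polyfun G ->
  harmonic_polyfun (fun x => F x - G x).
Proof.
move=> [pF lF] [pG lG]; split; first exact: polyfunB.
by move=> x; rewrite (laplacianB _ pF pG) lF lG subr0.
Qed.

Lemma harmonic_polyfun_cst a : harmonic_polyfun (fun=> a).
Proof. by split; [exact: polyfun_cst|move=> x; rewrite laplacian_cst]. Qed.

Lemma harmonic_polyfun_dot x : harmonic_polyfun (dot x).
Proof. by split; [exact: polyfun_dot|exact: laplacian_dot]. Qed.

Lemma harmonic_polyfun_shift c F : harmonic_polyfun F ->
  harmonic_polyfun (fun x => F (x - c)).
Proof.
by move=> [pF lF]; split=> [|x]; [exact: polyfun_shift|rewrite laplacian_shift lF].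
Qed.

Lemma harmonic_polyfun_mirror F : harmonic_polyfun F ->
  harmonic_polyfun (F \o mirror).
Proof.
by move=> [pF lF]; split=> [|x]; [exact: polyfun_mirror|rewrite laplacian_mirror].
Qed.

Lemma enorm_le x r : 0 <= r -> (enorm x <= r) = (sqn x <= r ^+ 2).
Proof.
by move=> r0; rewrite /enorm -{1}(ger0_norm r0) -sqrtr_sqr ler_sqrt// sqr_ge0.
Qed.

Lemma enorm_lt x r : 0 < r -> (enorm x < r) = (sqn x < r ^+ 2).
Proof.
move=> r0; rewrite /enorm -{1}(gtr0_norm r0) -sqrtr_sqr ltr_sqrt//.
by rewrite exprn_gt0.
Qed.

Lemma enorm_eq x r : 0 <= r -> (enorm x = r) <-> (sqn x = r ^+ 2).
Proof.
move=> r0; split=> [<-|e]; first by rewrite /enorm sqr_sqrtr// sqn_ge0.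
by rewrite /enorm -/(sqn x) e sqrtr_sqr ger0_norm.
Qed.

Lemma near_sqn_ball (P : E -> Prop) c : (\forall x \near c, P x) ->
  exists2 r, 0 < r & forall s, sqn s <= r ^+ 2 -> P (c + s).
Proof.
move=> /nbhs_ballP[r /= r0 rP]; exists (r / 2); first by rewrite divr_gt0.
move=> s sr; apply: rP; rewrite -ball_normE /ball_ /= opprD addNKr normrN.
have : `|s| <= r / 2.
  rewrite -(ler_pXn2r (n := 2))// ?nnegrE ?divr_ge0 ?(ltW r0)//.
  exact: (le_trans (norm_sqr_le_sqn s) sr).
by move=> /le_lt_trans; apply; rewrite ltr_pdivrMr// ltr_pMr// ltr1n.
Qed.

Lemma subharmonic_center U u c r F : subharmonic_on U u -> 0 < r ->
  (forall s, sqn s <= r ^+ 2 -> U (c + s)) -> harmonic_polyfun F ->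
  (forall s, sqn s = r ^+ 2 -> u (c + s) <= F s) -> u c <= F 0.
Proof.
move=> [_ uU] r0 cU hF uF.
have [pF lF] := harmonic_polyfun_shift c hF.
rewrite -(subrr c); apply: (uU c r (fun x => F (x - c))) => //.
- move=> x; rewrite /ecball /= (enorm_le _ (ltW r0)) => xr.
  by rewrite -(subrK c x) addrC; exact: cU.
- exact/continuous_subspaceT/polyfun_continuous.
- by split => //; exact: polyfun_Ck.
- move=> x /(enorm_eq _ (ltW r0)) xr.
  by rewrite -{1}(subrK c x) addrC; exact: uF.
- by rewrite /ecball /= subrr (enorm_le _ (ltW r0)) sqn0 sqr_ge0.
Qed.

Lemma add_continuous_l c : continuous (fun x : E => c + x).
Proof. by move=> x; apply: continuousD; [exact: cst_continuous|exact: cvg_id]. Qed.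

Lemma usc_shift A B c u : usc A u -> (forall s, B s -> A (c + s)) ->
  usc B (fun s => u (c + s)).
Proof. by move=> uA BA; exact: (usc_comp uA (@add_continuous_l c) BA). Qed.

Lemma polyfun_usc A F : polyfun F -> usc A F.
Proof. by move=> pF; exact/continuous_usc/polyfun_continuous. Qed.

(* At an interior maximum, a harmonic function inserted between [u + G] and
   [v] on a small sphere contradicts the two mean value inequalities. *)
Lemma no_interior_max A U u v x y r G ka : usc A u -> usc A (fun z => - v z) ->
  U `<=` A -> subharmonic_on U u -> superharmonic_on U v ->
  0 < r -> 0 < ka -> harmonic_polyfun G ->
  (forall s, sqn s <= r ^+ 2 -> U (y + s) /\ U (x + s)) ->
  (forall s, sqn s <= r ^+ 2 ->
     u (y + s) + G s + ka * sqn s - v (x + s) <= u y + G 0 - v x) -> False.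
Proof.
move=> uA vA UA uU vU r0 ka0 hG rU maxs.
(* [e] is half of the gain [ka r^2] on the sphere: it leaves strict room for the insertion there and
   remains as a contradiction at the center. *)
pose W := u y + G 0 - v x; pose e := ka * r ^+ 2 / 2.
have e0 : 0 < e by rewrite divr_gt0// mulr_gt0// exprn_gt0.
have [|||H hH uHv] := @harmpoly_insertion R n (r ^+ 2)
    (fun s => u (y + s) + (G s + (e - W))) (fun s => - v (x + s)).
- apply: uscD; last first.
    by apply: polyfun_usc; apply: polyfunD; [exact: hG.1|exact: polyfun_cst].
  by apply: (usc_shift uA) => s /= sr; apply/UA/(rU s _).1; rewrite sr.
- by apply: (usc_shift vA) => s /= sr; apply/UA/(rU s _).2; rewrite sr.
- move=> s sr; have := maxs s; rewrite sr lexx -/W => /(_ isT).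
  by move: e0; rewrite /e; lra.
have hH' := harmpolyW hH.
have : u y <= H 0 - (G 0 + (e - W)).
  apply: (subharmonic_center uU r0 _ (F := fun s => H s - (G s + (e - W)))).
  - by move=> s /rU[].
  - exact: (harmonic_polyfunB hH' (harmonic_polyfunD hG (harmonic_polyfun_cst _))).
  - by move=> s /uHv/andP[]; lra.
have : - v x <= -1 * H 0.
  apply: (subharmonic_center vU r0 _ (F := fun s => -1 * H s)).
  - by move=> s /rU[].
  - exact: harmonic_polyfunZ.
  - by move=> s /uHv/andP[] /=; lra.
rewrite /W; lra.
Qed.

Lemma x1_continuous : continuous (@x1 R n).
Proof. exact: coord_continuous_fun. Qed.

Lemma x1D x y : x1 (x + y) = x1 x + x1 y.
Proof. by rewrite /x1 mxE. Qed.

Definition half_cball (r : R) : set E := [set s | sqn s <= r ^+ 2 /\ 0 <= x1 s].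

Lemma compact_half_cball r : compact (half_cball r).
Proof.
apply: (@compact_sqn_closed _ _ (r ^+ 2)) => [|s []//].
apply: (@closedI _ [set s | sqn s <= r ^+ 2] [set s | 0 <= x1 s]).
  apply: (closed_comp (f := @sqn R n) (D := [set z | z <= r ^+ 2])) => [x _|].
    exact: sqn_continuous.
  exact: closed_le.
apply: (closed_comp (f := @x1 R n) (D := [set z | 0 <= z])) => [x _|].
  exact: x1_continuous.
exact: closed_ge.
Qed.

(** Subharmonicity tests only balls inside the open set, so the flat face is reached by
    semicontinuity: [u - F + ta |s|^2] attains its maximum on the closed half ball, and a small
    sphere excludes an interior maximum. *)
Lemma half_ball_comparison A U u y r F : usc A u -> subharmonic_on U u -> 0 < r ->
  (forall s, half_cball r s -> A (y + s)) ->
  (forall s, sqn s < r ^+ 2 -> 0 < x1 s -> U (y + s)) -> harmonic_polyfun F ->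
  (forall s, half_cball r s -> x1 s = 0 \/ sqn s = r ^+ 2 -> u (y + s) <= F s) ->
  forall s, half_cball r s -> u (y + s) <= F s.
Proof.
move=> uA uU r0 HA HU hF bd s Hs; rewrite leNgt; apply/negP => Fu.
pose P := u (y + s) - F s; have P0 : 0 < P by rewrite subr_gt0.
(* The perturbation then costs at most [P / 2], too little to move the maximum to the boundary. *)
pose ta := P / (2 * r ^+ 2).
have r20 : 0 < r ^+ 2 by rewrite exprn_gt0.
have ta0 : 0 < ta by rewrite divr_gt0// mulr_gt0.
have tar : ta * r ^+ 2 = P / 2 by rewrite /ta; field; rewrite gt_eqF.
have [pF _] := hF.
have usc1 : usc (half_cball r) (fun s => u (y + s) + (ta * sqn s - F s)).
  apply: uscD; first exact: usc_shift uA HA.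
  by apply: polyfun_usc; apply: polyfunB => //; apply: polyfunZ; exact: polyfun_sqn.
have [s0 Hs0 s0max] := usc_max (@compact_half_cball r) (ex_intro _ s Hs) usc1.
have big : P <= u (y + s0) + (ta * sqn s0 - F s0).
  apply: le_trans (s0max s Hs); rewrite /P.
  by have := mulr_ge0 (ltW ta0) (sqn_ge0 s); lra.
have s0in : 0 < x1 s0 /\ sqn s0 < r ^+ 2.
  have [s0r s01] := Hs0.
  have nbd : ~ (x1 s0 = 0 \/ sqn s0 = r ^+ 2).
    move=> /(bd _ Hs0) uF; have : ta * sqn s0 <= P / 2 by rewrite -tar ler_pM2l.
    by move: big uF P0; lra.
  rewrite !lt_neqAle s01 s0r !andbT; split; apply/eqP => e; apply: nbd.
    by left.
  by right.
have [rh rh0 rhP] : exists2 rh, 0 < rh & forall t, sqn t <= rh ^+ 2 ->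
    0 < x1 (s0 + t) /\ sqn (s0 + t) < r ^+ 2.
  apply: (@near_sqn_ball (fun z => 0 < x1 z /\ sqn z < r ^+ 2)); apply: filterI.
    by apply: (cvgr_gt (x1 s0) (@x1_continuous s0)); exact: s0in.1.
  by apply: (cvgr_lt (sqn s0) (@sqn_continuous R n s0)); exact: s0in.2.
pose m := u (y + s0) + (ta * sqn s0 - F s0).
(* On the sphere of radius [rh] about [s0], [|s0 + t|^2] is the affine function
   [|s0|^2 + 2 s0.t + rh^2], which exceeds it by [rh^2] at the center. *)
pose F' t := F (t - - s0) + (m - ta * sqn s0 - ta * rh ^+ 2) - 2 * ta * dot s0 t.
have : u (y + s0) <= F' 0.
  apply: (subharmonic_center uU rh0) => [t /rhP[t1 t2]||t].
  - by rewrite -addrA; exact: HU.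
  - exact: (harmonic_polyfunB (harmonic_polyfunD (harmonic_polyfun_shift (- s0) hF)
      (harmonic_polyfun_cst _)) (harmonic_polyfunZ _ (harmonic_polyfun_dot s0))).
  - move=> trh; have := rhP t; rewrite trh lexx => /(_ isT)[t1 t2].
    have := s0max (s0 + t) (conj (ltW t2) (ltW t1)).
    by rewrite -addrA -/m /F' opprK (addrC t) sqnD_dot trh; lra.
have : 0 < ta * rh ^+ 2 by rewrite mulr_gt0// exprn_gt0.
by rewrite /F' opprK add0r dotx0 /m; lra.
Qed.

Lemma mirrorE x : mirror x = x + (- (2 * x1 x)) *: basis_vec ord0.
Proof.
apply/rowP => i; rewrite !mxE eqxx /=; case: (eqVneq i ord0) => [->|_] /=.
  by rewrite /x1; ring.
by rewrite mulr0 addr0.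
Qed.

Lemma continuous_id_add (f : E -> E) :
  continuous f -> continuous (fun x => x + f x).
Proof.
move=> cf x; have := @continuousD R E E (fun x => x) f x _ (cf x).
by apply; exact: cvg_id.
Qed.

Lemma continuous_scale_vec (f : E -> R) (e : E) :
  continuous f -> continuous (fun x => f x *: e).
Proof. by move=> cf x; exact: (@continuousZr_tmp R E E f e x (cf x)). Qed.

Lemma mirror_continuous : continuous (@mirror R n).
Proof.
have -> : @mirror R n = fun x => x + (- (2 * x1 x)) *: basis_vec ord0.
  by apply/funext => z; rewrite mirrorE.
have cZ : continuous (fun x : E => (- (2 * x1 x)) *: basis_vec ord0 : E).
  exact/continuous_scale_vec/(@opp_mul_continuous R E 2 _ x1_continuous).
exact: continuous_id_add.
Qed.

Lemma x1_mirror x : x1 (mirror x) = - x1 x.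
Proof. by rewrite /x1 mxE eqxx. Qed.

Lemma sqn_mirror x : sqn (mirror x) = sqn x.
Proof. by apply: eq_bigr => i _; rewrite mxE; case: ifP; rewrite ?sqrrN. Qed.

Lemma mirror_id x : x1 x = 0 -> mirror x = x.
Proof. by move=> x0; rewrite mirrorE x0 mulr0 oppr0 scale0r addr0. Qed.

Section OddInsertion.
Variables (q w : R) (a b : E -> R).
Let S := [set s : E | sqn s = q /\ 0 <= x1 s].
Hypothesis w0 : 0 < w.
Hypothesis aS : usc S a.
Hypothesis bS : usc S b.
Hypothesis ab_rim : forall s, sqn s = q -> x1 s = 0 -> a s <= 0 /\ b s <= 0.
Hypothesis ab : forall s, S s -> a s + b s <= 0.

(** For an odd function, the upper bound [- b] at the mirror image is a lower bound on the other
    half. On the rim, [ab_rim] lets the two halves meet upper semicontinuously at the value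
    [- w]. *)
Let Lo s := if 0 < x1 s then a s - w
            else if x1 s < 0 then b (mirror s) - w else - w.

Let usc_Lo : usc [set s | sqn s = q] Lo.
Proof.
have bref : usc [set s | sqn s = q /\ x1 s <= 0] (b \o mirror).
  apply: (usc_comp bS) => [|s [sq s0]]; first exact: mirror_continuous.
  by split; rewrite ?sqn_mirror// x1_mirror oppr_ge0.
move=> s /= sq c; rewrite /Lo.
have [s0|s0|s0] := ltgtP (x1 s) 0 => sc.
- have n1 : \forall y \near s, x1 y < 0 by exact: (cvgr_lt (x1 s) (@x1_continuous s)).
  have : (b \o mirror) s < c + w by rewrite /=; lra.
  move=> /(bref s (conj sq (ltW s0))) n2.
  apply: filterS2 n1 n2 => y; case: ltgtP => //= y0 _ + yq.
  by move=> /(_ (conj yq (ltW y0))); lra.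
- have n1 : \forall y \near s, 0 < x1 y by exact: (cvgr_gt (x1 s) (@x1_continuous s)).
  have : a s < c + w by lra.
  move=> /(aS (conj sq (ltW s0))) n2.
  apply: filterS2 n1 n2 => y y0 + yq; rewrite y0.
  by move=> /(_ (conj yq (ltW y0))); lra.
- have [a0 b0] := ab_rim sq s0.
  have : a s < c + w by lra.
  have Ss : S s by split => //; rewrite s0.
  move=> /(aS Ss) n1.
  have : (b \o mirror) s < c + w by rewrite /= mirror_id//; lra.
  have Ss' : sqn s = q /\ x1 s <= 0 by split => //; rewrite s0.
  move=> /(bref s Ss') n2.
  apply: filterS2 n1 n2 => y n1 n2 yq.
  have [y0|y0|_] := ltgtP (x1 y) 0; last by lra.
  + by have := n2 (conj yq (ltW y0)); rewrite /=; lra.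
  + by have := n1 (conj yq (ltW y0)); lra.
Qed.

(* Insertion on the whole sphere between an odd pair of bounds, followed by
   odd symmetrization. *)
Lemma odd_harmonic_insertion : exists H, [/\ harmonic_polyfun H,
  forall s, x1 s = 0 -> H s = 0 &
  forall s, S s -> a s - w <= H s <= - b s + w].
Proof.
have [|||H hH Lo_H] := @harmpoly_insertion R n q Lo (Lo \o mirror).
- exact: usc_Lo.
- apply: (usc_comp usc_Lo) => [|s]; first exact: mirror_continuous.
  by rewrite /= sqn_mirror.
- move=> s sq; rewrite /Lo /= x1_mirror oppr_gt0 oppr_lt0 mirrorK.
  case: (ltgtP (x1 s) 0) => s0 /=; last by move: w0; lra.
  + have := ab (s := mirror s); rewrite /S /= sqn_mirror x1_mirror oppr_ge0.
    by move=> /(_ (conj sq (ltW s0))); move: w0; lra.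
  + by have := ab (conj sq (ltW s0)); move: w0; lra.
have hH' := harmpolyW hH.
exists (fun s => 2^-1 * (H s - (H \o mirror) s)); split.
- exact: (harmonic_polyfunZ _ (harmonic_polyfunB hH' (harmonic_polyfun_mirror hH'))).
- by move=> s s0; rewrite /= mirror_id// subrr mulr0.
- move=> s [sq]; rewrite le_eqVlt => /orP[/eqP s0|s0].
    have [a0 b0] := ab_rim sq (esym s0).
    by rewrite /= mirror_id// subrr mulr0; apply/andP; split; move: w0; lra.
  have := Lo_H s sq; have := Lo_H (mirror s); rewrite sqn_mirror => /(_ sq).
  rewrite /Lo /= mirrorK x1_mirror s0 oppr_gt0 oppr_lt0 s0.
  rewrite (lt_gtF s0).
  by move=> /andP[? ?] /andP[? ?]; apply/andP; split; move: w0; lra.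
Qed.

End OddInsertion.

End Comparison.

(** * Contact on the hyperplane *)

Section BoundaryContact.
Context {R : realType} {n : nat}.
Local Notation E := 'rV[R]_n.+1.
Implicit Types (u v F G H : E -> R) (x y z s t p : E) (i : 'I_n.+1).
Local Notation e1 := (basis_vec (ord0 : 'I_n.+1) : E).
Local Notation C := (closure (half_ball 1) : set E).
Local Notation dim := (n.+1%:R : R).

Lemma dotDl p q s : dot (p + q) s = dot p s + dot q s.
Proof. by rewrite /dot -big_split; apply: eq_bigr => i _; rewrite mxE mulrDl. Qed.

Lemma dotZl a p s : dot (a *: p) s = a * dot p s.
Proof. by rewrite /dot mulr_sumr; apply: eq_bigr => i _; rewrite mxE mulrA. Qed.

Lemma dot_basis s : dot e1 s = x1 s.
Proof.
rewrite /dot (bigD1 ord0)//= big1 => [|i i0]; first by rewrite !mxE !eqxx mul1r addr0.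
by rewrite mxE eqxx (negPf i0) mul0r.
Qed.

Lemma x1_sqr_le_sqn s : (x1 s) ^+ 2 <= sqn s.
Proof. exact: coord_sqn. Qed.

Lemma closed_half_cball r : closed (half_cball r : set E).
Proof. exact/(compact_closed (@norm_hausdorff _ E))/compact_half_cball. Qed.

Lemma half_ball1 x : half_ball 1 x <-> sqn x < 1 /\ 0 < x1 x.
Proof.
by rewrite /half_ball /eball /= /setI /= subr0 enorm_lt// expr1n.
Qed.

Lemma flat_ball1 x : flat_ball 1 x <-> sqn x < 1 /\ x1 x = 0.
Proof.
by rewrite /flat_ball /eball /= /setI /= subr0 enorm_lt// expr1n.
Qed.

Lemma closure_half_ball : C = half_cball 1.
Proof.
apply/seteqP; split=> [x|x [x1n x10]].
  move=> Cx; apply: closed_half_cball; apply: closureS Cx => z /half_ball1[z1 z2].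
  by split; rewrite ?expr1n ltW.
move=> B /near_sqn_ball[r r0 rB]; rewrite expr1n in x1n.
(* The point [x] is moved a little toward the interior point [e1 / 2]. *)
pose w := 2^-1 *: e1 - x; pose K := sqn w.
have K0 : 0 <= K := sqn_ge0 w.
pose t := Num.min 1 (r / (K + 1)).
have rK : 0 < r / (K + 1) by rewrite divr_gt0// ltr_wpDl.
have t0 : 0 < t by rewrite lt_min ltr01.
have t1 : t <= 1 by rewrite ge_min lexx.
have tr : t * (K + 1) <= r.
  by rewrite -ler_pdivlMr ?ltr_wpDl// ge_min lexx orbT.
exists (x + t *: w); split; last first.
  apply: rB; rewrite sqnZ -/K.
  apply: (@le_trans _ _ ((t * (K + 1)) ^+ 2)).
    rewrite exprMn ler_wpM2l ?sqr_ge0//; nra.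
  by rewrite lerXn2r// nnegrE ?mulr_ge0 ?addr_ge0// ltW.
have x11 : (x1 x) ^+ 2 <= 1 := le_trans (x1_sqr_le_sqn x) x1n.
apply/half_ball1; split; last first.
  by rewrite x1D /x1 /w !mxE eqxx /=; rewrite /x1 in x10; nra.
rewrite (_ : x + t *: w = (1 - t) *: x + (t / 2) *: e1); last first.
  by apply/rowP => j; rewrite !mxE; ring.
rewrite sqnD_basis sqnZ mxE -/(x1 x).
have x1le : x1 x <= 1 by nra.
have : (1 - t) ^+ 2 * sqn x <= (1 - t) ^+ 2 by rewrite ler_piMr ?sqr_ge0.
have : 2 * (t / 2) * ((1 - t) * x1 x) <= t * (1 - t).
  rewrite (_ : 2 * (t / 2) = t); last by field.
  by rewrite mulrA ler_piMr// mulr_ge0 ?subr_ge0// ltW.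
nra.
Qed.

(** The harmonic function that equals [|s|^2] on the hyperplane; its gradient vanishes at the
    origin. *)
Definition saddle s := sqn s - dim * (s ord0 ord0 * s ord0 ord0).

Lemma polyfun_x1sqr : polyfun (fun s : E => s ord0 ord0 * s ord0 ord0).
Proof. exact/polyfun_coordM/polyfun_coord. Qed.

Lemma laplacian_x1sqr s : laplacian (fun s : E => s ord0 ord0 * s ord0 ord0) s = 2.
Proof.
rewrite (laplacian_coordM _ _ (polyfun_coord _)) laplacian_coord partial_coord.
by rewrite eqxx mulr0 add0r mulr1.
Qed.

Lemma polyfun_saddle : polyfun saddle.
Proof. exact: (polyfunB polyfun_sqn (polyfunZ _ polyfun_x1sqr)). Qed.

Lemma harmonic_saddle : harmonic_polyfun saddle.
Proof.
split=> [|x]; first exact: polyfun_saddle.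
rewrite (laplacianB _ polyfun_sqn (polyfunZ _ polyfun_x1sqr)).
by rewrite (laplacianZ _ _ polyfun_x1sqr) laplacian_x1sqr laplacian_sqn; ring.
Qed.

Lemma partial_x1sqr i : partial i (fun s : E => s ord0 ord0 * s ord0 ord0) 0 = 0.
Proof. by rewrite (partial_coordM _ _ (polyfun_coord _)) mxE mul0r mulr0 addr0. Qed.

Lemma partial_saddle i : partial i saddle 0 = 0.
Proof.
rewrite (partialB _ polyfun_sqn (polyfunZ _ polyfun_x1sqr)).
by rewrite (partialZ _ _ polyfun_x1sqr) partial_x1sqr partial_sqn mxE !mulr0 subr0.
Qed.

Lemma saddle_flat s : x1 s = 0 -> saddle s = sqn s.
Proof. by rewrite /x1 /saddle => ->; rewrite mulr0 mulr0 subr0. Qed.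

(** For harmonic [H] every term but the last is harmonic, so [be] alone fixes the sign of the
    Laplacian, while [p] and [H] alone fix the gradient at the origin. *)
Definition test_fun (c : R) p H (al be : R) s :=
  c + dot p s + H s + al * saddle s + be * (s ord0 ord0 * s ord0 ord0).

Section TestFunction.
Variables (c : R) (p : E) (H : E -> R) (al be : R).
Hypothesis hH : harmonic_polyfun H.

Let h0 := harmonic_polyfunD (harmonic_polyfunD (harmonic_polyfunD
  (harmonic_polyfun_cst c) (harmonic_polyfun_dot p)) hH)
  (harmonic_polyfunZ al harmonic_saddle).

Lemma polyfun_test : polyfun (test_fun c p H al be).
Proof. exact: (polyfunD h0.1 (polyfunZ be polyfun_x1sqr)). Qed.

Lemma laplacian_test s : laplacian (test_fun c p H al be) s = 2 * be.
Proof.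
rewrite (laplacianD _ h0.1 (polyfunZ be polyfun_x1sqr)) h0.2 add0r.
by rewrite (laplacianZ _ _ polyfun_x1sqr) laplacian_x1sqr mulrC.
Qed.

Lemma partial_test i :
  partial i (test_fun c p H al be) 0 = p ord0 i + partial i H 0.
Proof.
have pc := polyfun_cst (n := n) c; have pp := polyfun_dot p.
have ps := polyfunZ al polyfun_saddle; have pb := polyfunZ be polyfun_x1sqr.
have pH := hH.1; have p1 := polyfunD pc pp; have p2 := polyfunD p1 pH.
rewrite (partialD _ (polyfunD p2 ps) pb) (partialD _ p2 ps) (partialD _ p1 pH).
rewrite (partialD _ pc pp) partial_cst partial_dot.
rewrite (partialZ _ _ polyfun_saddle) (partialZ _ _ polyfun_x1sqr).
by rewrite partial_saddle partial_x1sqr !mulr0 !addr0 add0r.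
Qed.

Lemma test_fun0 : test_fun c p H al be 0 = c + H 0.
Proof.
by rewrite /test_fun dotx0 /saddle sqn0 mxE !mulr0 subr0 mulr0 !addr0.
Qed.

End TestFunction.

Lemma partial_flat i H : i != ord0 -> (forall s, x1 s = 0 -> H s = 0) ->
  partial i H 0 = 0.
Proof.
move=> i0 H0; rewrite /partial /derive.
rewrite (_ : (fun h => _) = (fun=> 0)); last first.
  apply/funext => h; rewrite /= !H0 ?subrr ?scaler0// /x1 !mxE ?addr0//.
  by rewrite eq_sym (negPf i0) andbF mulr0.
by apply: lim_cst; exact: norm_hausdorff.
Qed.

Lemma flat_interior y : sqn y < 1 -> exists2 r, 0 < r &
  forall s, sqn s <= r ^+ 2 -> sqn (y + s) < 1.
Proof.
move=> y1; apply: (@near_sqn_ball _ _ (fun z => sqn z < 1)).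
exact: (cvgr_lt (sqn y) (@sqn_continuous R n y)).
Qed.

Lemma touch_near (Q : E -> Prop) y r : 0 < r ->
  (forall s, sqn s <= r ^+ 2 -> Q (y + s)) ->
  \forall z \near y, Q z.
Proof.
move=> r0 rQ; have : \forall z \near y, sqn (z - y) < r ^+ 2.
  have c : continuous (fun z => sqn (z - y)).
    exact/polyfun_continuous/polyfun_shift/polyfun_sqn.
  apply: (cvgr_lt (sqn (y - y)) (c y)).
  by rewrite subrr sqn0 exprn_gt0.
by apply: filterS => z /ltW /rQ; rewrite addrC subrK.
Qed.

(* After subtracting harmonic paraboloids, an odd harmonic polynomial separates
   the remainders of [u] and [v] on a half ball. Its normal derivative at the
   center makes the slope of [u] negative or that of [v] positive. *)
Lemma boundary_contact u v x y p k eta Cu Cv ta rho :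
  subsolution u -> supersolution v ->
  sqn x < 1 -> x1 x = 0 -> sqn y < 1 -> x1 y = 0 -> x1 p = 0 -> x1 k = 0 ->
  0 < eta -> 0 < Cu -> 0 < Cv -> ta <= Cu + Cv -> 0 < rho ->
  (forall s, sqn s <= rho ^+ 2 -> x1 s = 0 -> u (y + s) <= u y + dot p s + Cu * sqn s) ->
  (forall s, sqn s <= rho ^+ 2 -> x1 s = 0 -> v x + dot k s - Cv * sqn s <= v (x + s)) ->
  (forall s, half_cball rho s -> u (y + s) - v (x + s) <=
     u y - v x - eta * x1 s + (dot p s - dot k s) + ta * sqn s) ->
  k = 0.
Proof.
move=> [uC uH uB] [vC vH vB] x1n x10 y1n y10 p10 k10 eta0 Cu0 Cv0 taC rho0 Hu Hv Hd.
apply/eqP; apply/negP => /negP k0.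
have {}uC := usc_on_usc uC; have {}vC := lsc_on_usc vC.
have dim0 : 0 < dim by rewrite ltr0n.
have [rx rx0 rxP] := flat_interior x1n; have [ry ry0 ryP] := flat_interior y1n.
(* For [0 <= x_1 <= r0] the term [(Cu + Cv) d x_1^2] left by the two saddles is at most
   [eta x_1 / 2]. *)
pose r0 := eta / (2 * dim * (Cu + Cv)).
have C0 : 0 < Cu + Cv by exact: addr_gt0.
have r00 : 0 < r0 by rewrite divr_gt0// !mulr_gt0.
pose r := Num.min (Num.min rho r0) (Num.min rx ry).
have r_gt0 : 0 < r by rewrite !lt_min rho0 r00 rx0 ry0.
have sq_mono (a : R) : r <= a -> r ^+ 2 <= a ^+ 2.
  by move=> ra; rewrite lerXn2r// nnegrE ?(ltW r_gt0)// (le_trans (ltW r_gt0)).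
have r_rho : r ^+ 2 <= rho ^+ 2 by apply: sq_mono; rewrite !ge_min lexx.
have r_rx : r ^+ 2 <= rx ^+ 2 by apply: sq_mono; rewrite !ge_min lexx !orbT.
have r_ry : r ^+ 2 <= ry ^+ 2 by apply: sq_mono; rewrite !ge_min lexx !orbT.
have rC : (Cu + Cv) * dim * r <= eta / 2.
  have : r <= r0 by rewrite !ge_min lexx orbT.
  rewrite /r0 ler_pdivlMr ?mulr_gt0//; lra.
have x1D0 z s : x1 z = 0 -> x1 (z + s) = x1 s by rewrite x1D => ->; rewrite add0r.
have xC s : half_cball r s -> C (x + s).
  move=> [sr s0]; rewrite closure_half_ball; split; last by rewrite x1D0.
  by rewrite expr1n ltW// rxP// (le_trans sr).
have yC s : half_cball r s -> C (y + s).
  move=> [sr s0]; rewrite closure_half_ball; split; last by rewrite x1D0.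
  by rewrite expr1n ltW// ryP// (le_trans sr).
have xU s : sqn s < r ^+ 2 -> 0 < x1 s -> half_ball 1 (x + s).
  move=> sr s0; apply/half_ball1; split; last by rewrite x1D0.
  by rewrite rxP// (le_trans (ltW sr)).
have yU s : sqn s < r ^+ 2 -> 0 < x1 s -> half_ball 1 (y + s).
  move=> sr s0; apply/half_ball1; split; last by rewrite x1D0.
  by rewrite ryP// (le_trans (ltW sr)).
have s1r s : sqn s <= r ^+ 2 -> 0 <= x1 s -> x1 s <= r.
  move=> sr s0; rewrite -(ler_pXn2r (n := 2))// ?nnegrE ?(ltW r_gt0)//.
  exact: le_trans (x1_sqr_le_sqn s) sr.
pose S := [set s : E | sqn s = r ^+ 2 /\ 0 <= x1 s].
have Sr s : S s -> half_cball r s by move=> [sr s0]; split=> //; rewrite sr.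
pose Qu s := u y + dot p s + Cu * saddle s.
pose Qv s := v x + dot k s - Cv * saddle s.
have hQu : harmonic_polyfun Qu.
  exact: (harmonic_polyfunD (harmonic_polyfunD (harmonic_polyfun_cst _)
    (harmonic_polyfun_dot p)) (harmonic_polyfunZ Cu harmonic_saddle)).
have hQv : harmonic_polyfun Qv.
  exact: (harmonic_polyfunB (harmonic_polyfunD (harmonic_polyfun_cst _)
    (harmonic_polyfun_dot k)) (harmonic_polyfunZ Cv harmonic_saddle)).
(* Half of the slope gap [eta] goes into [b], to separate the slopes of the two test functions; the
   other half absorbs the saddles in [a + b <= 0]. *)
pose a s := u (y + s) + (-1 * Qu s).
pose b s := - v (x + s) + (Qv s + eta / 2 * x1 s).
have px1 : polyfun (@x1 R n) by exact: polyfun_coord.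
have aS : usc S a.
  apply: uscD; first by apply: (usc_shift uC) => s /Sr /yC.
  by apply: polyfun_usc; exact: (polyfunZ _ hQu.1).
have bS : usc S b.
  apply: uscD; first by apply: (usc_shift vC) => s /Sr /xC.
  by apply: polyfun_usc; exact: (polyfunD hQv.1 (polyfunZ _ px1)).
have u_flat s : sqn s <= r ^+ 2 -> x1 s = 0 -> u (y + s) <= Qu s.
  by move=> sr s0; rewrite /Qu saddle_flat// Hu// (le_trans sr).
have v_flat s : sqn s <= r ^+ 2 -> x1 s = 0 -> Qv s <= v (x + s).
  by move=> sr s0; rewrite /Qv saddle_flat// Hv// (le_trans sr).
(* Chosen so that the barrier [w psi] below has normal slope [eta / 16] at the center ([wr]). *)
pose w := eta * r / (16 * dim).
have w0 : 0 < w by rewrite divr_gt0 ?mulr_gt0.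
have [||H [hH H0 abH]] := odd_harmonic_insertion w0 aS bS.
- move=> s sr s0; have := u_flat s; have := v_flat s; rewrite sr lexx.
  by move=> /(_ isT s0) h1 /(_ isT s0) h2; rewrite /a /b s0; split; lra.
- move=> s [sr s0]; have sh : half_cball r s by apply: Sr.
  have := Hd s (conj (le_trans sh.1 r_rho) s0).
  have s1 := s1r s sh.1 s0.
  have : (Cu + Cv) * dim * (x1 s * x1 s) <= eta / 2 * x1 s.
    rewrite mulrA ler_wpM2r// (le_trans _ rC)// ler_pM2l//.
    by rewrite mulr_gt0.
  have : ta * sqn s <= (Cu + Cv) * sqn s by rewrite ler_wpM2r ?sqn_ge0.
  by rewrite /a /b /Qu /Qv /saddle -/(x1 s); lra.
(* A harmonic barrier for the insertion error [w]: at least 1 on the half sphere, nonnegative on the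
   flat face, zero at the center. *)
pose psi s := (r ^+ 2)^-1 * (saddle s + dim * r * x1 s).
have hpsi : harmonic_polyfun psi.
  apply: harmonic_polyfunZ; apply: (harmonic_polyfunD harmonic_saddle).
  by split; [exact: polyfunZ|move=> s; rewrite (laplacianZ _ _ px1) laplacian_coord mulr0].
have r2 : 0 < r ^+ 2 by rewrite exprn_gt0.
have psi_flat s : x1 s = 0 -> 0 <= psi s.
  move=> s0; rewrite /psi saddle_flat// s0 mulr0 addr0.
  by rewrite mulr_ge0 ?sqn_ge0// invr_ge0 ltW.
have psi_S s : S s -> 1 <= psi s.
  move=> [sr s0]; rewrite /psi mulrC ler_pdivlMr// mul1r /saddle sr -/(x1 s).
  have s1 : x1 s <= r by apply: s1r; rewrite ?sr.
  have : dim * (x1 s * x1 s) <= dim * (r * x1 s) by rewrite ler_pM2l// ler_wpM2r.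
  by lra.
have u_le s : half_cball r s -> u (y + s) <= Qu s + (H s + w * psi s).
  apply: (half_ball_comparison (F := fun s => Qu s + (H s + w * psi s))
    uC uH r_gt0 yC yU) => [|t [tr t0] [t00|tr']].
  - exact: (harmonic_polyfunD hQu (harmonic_polyfunD hH (harmonic_polyfunZ w hpsi))).
  - have := u_flat t tr t00; rewrite H0// add0r.
    by have := mulr_ge0 (ltW w0) (psi_flat t t00); lra.
  - have := psi_S t (conj tr' t0); rewrite -(ler_pM2l w0) mulr1.
    by have /andP[] := abH t (conj tr' t0); rewrite /a; lra.
have v_ge s : half_cball r s ->
    - v (x + s) <= w * psi s - (Qv s + (eta / 2 * x1 s + H s)).
  apply: (half_ball_comparison (u := fun z => - v z)
    (F := fun s => w * psi s - (Qv s + (eta / 2 * x1 s + H s)))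
    vC vH r_gt0 xC xU) => [|t [tr t0] [t00|tr']].
  - apply: (harmonic_polyfunB (harmonic_polyfunZ w hpsi)).
    apply: (harmonic_polyfunD hQv); apply: (harmonic_polyfunD _ hH).
    by split; [exact: polyfunZ|move=> s'; rewrite (laplacianZ _ _ px1) laplacian_coord mulr0].
  - have := v_flat t tr t00; rewrite H0// t00 mulr0 !addr0.
    by have := mulr_ge0 (ltW w0) (psi_flat t t00); lra.
  - have := psi_S t (conj tr' t0); rewrite -(ler_pM2l w0) mulr1.
    by have /andP[] := abH t (conj tr' t0); rewrite /b; lra.
have wr : w * (r ^+ 2)^-1 * (dim * r) = eta / 16.
  by rewrite /w; field; rewrite nat1r !gt_eqF.
(* The term [sg x_1 - x_1^2], nonnegative for [0 <= x_1 <= sg], gives the Laplacian its strict sign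
   at the price of a slope [sg]. *)
pose sg := eta / 16; have sg0 : 0 < sg by rewrite divr_gt0.
pose r' := Num.min r sg; have r'0 : 0 < r' by rewrite lt_min r_gt0.
have r'r : r' ^+ 2 <= r ^+ 2.
  by rewrite lerXn2r// ?nnegrE ?(ltW r'0) ?(ltW r_gt0)// ge_min lexx.
have r's s : sqn s <= r' ^+ 2 -> 0 <= x1 s -> x1 s <= sg.
  move=> sr s0; rewrite -(ler_pXn2r (n := 2))// ?nnegrE ?(ltW sg0)//.
  apply: le_trans (x1_sqr_le_sqn s) _; apply: (le_trans sr).
  by rewrite lerXn2r// ?nnegrE ?(ltW r'0) ?(ltW sg0)// ge_min lexx orbT.
have Cx1 z s : x1 z = 0 -> C (z + s) -> 0 <= x1 s.
  by move=> z0; rewrite closure_half_ball => -[_]; rewrite x1D0.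
pose Pu s := test_fun (u y) (p + (eta / 16 + sg) *: e1) H (Cu + w * (r ^+ 2)^-1) (-1) s.
pose Pv s := test_fun (v x) (k + (eta / 2 - eta / 16 - sg) *: e1) H
  (- Cv - w * (r ^+ 2)^-1) 1 s.
have PuE s : Pu s = Qu s + (H s + w * psi s) + (sg * x1 s - x1 s * x1 s).
  rewrite /Pu /test_fun /Qu /psi dotDl dotZl dot_basis -/(x1 s) -wr; ring.
have PvE s : Pv s = (Qv s + (eta / 2 * x1 s + H s)) - w * psi s
    - (sg * x1 s - x1 s * x1 s).
  rewrite /Pv /test_fun /Qv /psi dotDl dotZl dot_basis -/(x1 s) -wr; ring.
have Hz : H 0 = 0 by apply: H0; rewrite /x1 mxE.
have gap s : sqn s <= r' ^+ 2 -> 0 <= x1 s -> 0 <= sg * x1 s - x1 s * x1 s.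
  by move=> sr s0; rewrite subr_ge0 ler_wpM2r// r's.
have uBy : 0 <= eta / 16 + sg + partial ord0 H 0.
  have := uB y (fun z => Pu (z - y)); rewrite laplacian_shift partial_shift.
  rewrite subrr laplacian_test// partial_test// !mxE !eqxx -/(x1 p) p10 mulr1 add0r.
  apply.
  - by apply/flat_ball1.
  - exact/polyfun_smooth/polyfun_shift/polyfun_test.
  - split; first by rewrite subrr /Pu test_fun0 Hz addr0.
    apply: (touch_near r'0) => s sr Cs; have s0 := Cx1 _ _ y10 Cs.
    rewrite [y + s]addrC addrK addrC PuE.
    by have := u_le s (conj (le_trans sr r'r) s0); have := gap s sr s0; lra.
  - lra.
have vBx : eta / 2 - eta / 16 - sg + partial ord0 H 0 <= 0.
  have := vB x (fun z => Pv (z - x)); rewrite laplacian_shift partial_shift.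
  rewrite subrr laplacian_test// partial_test// !mxE !eqxx -/(x1 k) k10 /= !mulr1 add0r.
  (* As [H] vanishes on the hyperplane, the tangential gradient is that of [dot k]; since [k] is not
     zero, the condition on [v] must hold through the normal derivative. *)
  rewrite (_ : tangential_grad_norm _ _ = Num.sqrt (\sum_(i | i != ord0) k ord0 i ^+ 2)).
  have kpos : 0 < Num.sqrt (\sum_(i | i != ord0) k ord0 i ^+ 2).
    rewrite sqrtr_gt0 lt_neqAle sumr_ge0 ?andbT; last by move=> i _; exact: sqr_ge0.
    rewrite eq_sym; apply: contra k0 => /eqP ksum; apply/eqP/rowP => i; rewrite mxE.
    have [->|i0] := eqVneq i ord0; first exact: k10.
    apply/eqP; rewrite -sqrf_eq0; apply/eqP.
    by apply: (psumr_eq0P _ ksum i0) => j _; exact: sqr_ge0.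
  rewrite ge_min [X in _ || X]leNgt kpos orbF; apply.
  - by apply/flat_ball1.
  - exact/polyfun_smooth/polyfun_shift/polyfun_test.
  - split; first by rewrite subrr /Pv test_fun0 Hz addr0.
    apply: (touch_near r'0) => s sr Cs; have s0 := Cx1 _ _ x10 Cs.
    rewrite [x + s]addrC addrK addrC PvE.
    by have := v_ge s (conj (le_trans sr r'r) s0); have := gap s sr s0; lra.
  - lra.
  congr Num.sqrt; apply: eq_bigr => i i0.
  rewrite partial_shift subrr partial_test// (partial_flat i0 H0) addr0 !mxE.
  by rewrite (negPf i0) andbF mulr0 addr0.
(* With [h] the normal slope of [H], the two conditions read [3 eta / 8 <= - h <= eta / 8]. *)
by move: uBy vBx; rewrite /sg; lra.
Qed.

End BoundaryContact.

(** * Doubling of variables *)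

Section Doubling.
Context {R : realType} {n : nat}.
Local Notation E := 'rV[R]_n.+1.
Implicit Types (x y z s e w : E).
Local Notation e1 := (basis_vec (ord0 : 'I_n.+1) : E).
Local Notation C := (closure (half_ball 1) : set E).
Local Notation dim := (n.+1%:R : R).
Variables u v : E -> R.
Hypothesis hv : supersolution v.
Hypothesis hu : subsolution u.

Lemma dotNr x y : dot x (- y) = - dot x y.
Proof. by rewrite /dot -sumrN; apply: eq_bigr => i _; rewrite mxE mulrN. Qed.

Lemma closureC_sqn x : C x -> sqn x <= 1 /\ 0 <= x1 x.
Proof. by rewrite closure_half_ball => -[]; rewrite expr1n. Qed.

Lemma in_closureC x : sqn x <= 1 -> 0 <= x1 x -> C x.
Proof. by move=> xn x0; rewrite closure_half_ball; split=> //; rewrite expr1n. Qed.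

(** The linear term in [x_1] opens the slope gap on the hyperplane; the quadratic one outweighs the
    Laplacian of [- ta |y - z|^2] as long as [ta < eta / d]. *)
Definition gap (eta ta : R) z x y : R :=
  u y + eta * (x1 y + x1 y * x1 y) - ta * sqn (y - z) - v x.

(** Only the tangential variables are doubled: at equal heights, the penalization of [y - x - e]
    adds no normal slope. *)
Definition levels : set (E * E) := [set p | C p.1 /\ C p.2 /\ x1 p.1 = x1 p.2].

Lemma levelsI x y : sqn x <= 1 -> sqn y <= 1 -> 0 <= x1 x -> x1 x = x1 y ->
  levels (x, y).
Proof.
move=> xn yn x0 xy; split; first exact: in_closureC.
by split=> //; apply: in_closureC; rewrite // -xy.
Qed.

(** A common shift of both points leaves the penalization unchanged; it excludes positive heights
    and gives the slope gap on the hyperplane. There, moving [y] alone or [x] alone gives the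
    tangential quadratic bounds that [boundary_contact] needs. *)
Lemma doubling_max_flat (eta ta eps : R) z e x y :
  0 <= ta -> ta < eta / dim -> 0 < eps -> x1 z = 0 -> x1 e = 0 ->
  levels (x, y) -> sqn x < 1 -> sqn y < 1 ->
  (forall x' y', levels (x', y') ->
     gap eta ta z x' y' - sqn (y' - x' - e) / (2 * eps) <=
     gap eta ta z x y - sqn (y - x - e) / (2 * eps)) ->
  x1 x = 0 /\ y - x = e.
Proof.
move=> ta0 taeta eps0 z0 e0 [/= Cx [Cy xy]] xn yn maxg.
have dim0 : 0 < dim by rewrite ltr0n.
have eta0 : 0 < eta.
  by have := le_lt_trans ta0 taeta; rewrite pmulr_lgt0 ?invr_gt0.
have [rx rx0 rxP] := flat_interior xn; have [ry ry0 ryP] := flat_interior yn.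
pose r0 := Num.min rx ry; have r00 : 0 < r0 by rewrite lt_min rx0.
have r0x s : sqn s <= r0 ^+ 2 -> sqn (x + s) < 1.
  move=> sr; apply: rxP; apply: (le_trans sr).
  by rewrite lerXn2r// ?nnegrE ?(ltW r00) ?(ltW rx0)// ge_min lexx.
have r0y s : sqn s <= r0 ^+ 2 -> sqn (y + s) < 1.
  move=> sr; apply: ryP; apply: (le_trans sr).
  by rewrite lerXn2r// ?nnegrE ?(ltW r00) ?(ltW ry0)// ge_min lexx orbT.
have shift s : sqn s <= r0 ^+ 2 -> 0 <= x1 x + x1 s ->
    u (y + s) + (eta * x1 s + 2 * eta * x1 x * x1 s + eta * (x1 s * x1 s))
      - ta * (2 * dot (y - z) s + sqn s) - v (x + s) <= u y - v x.
  move=> sr xs0.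
  have /maxg : levels (x + s, y + s).
    by apply: levelsI; rewrite ?x1D -?xy// ltW ?r0x ?r0y.
  rewrite /gap x1D -xy (_ : y + s - z = (y - z) + s); last by rewrite addrAC.
  rewrite sqnD_dot (_ : y + s - (x + s) - e = y - x - e); last first.
    by rewrite opprD addrACA subrr addr0.
  by lra.
have [_] := closureC_sqn Cx; rewrite le_eqVlt => /orP[/eqP x0|x0]; last first.
  exfalso.
  have [r1 r10 r1P] : exists2 r1, 0 < r1 & forall s, sqn s <= r1 ^+ 2 -> 0 < x1 (x + s).
    apply: (@near_sqn_ball R n (fun z => 0 < x1 z)).
    exact: (cvgr_gt (x1 x) (@x1_continuous R n x)).
  pose r := Num.min r0 r1; have r_gt0 : 0 < r by rewrite lt_min r00.
  have rr0 : r ^+ 2 <= r0 ^+ 2.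
    by rewrite lerXn2r// ?nnegrE ?(ltW r00) ?(ltW r_gt0)// ge_min lexx.
  have rr1 : r ^+ 2 <= r1 ^+ 2.
    by rewrite lerXn2r// ?nnegrE ?(ltW r10) ?(ltW r_gt0)// ge_min lexx orbT.
  pose g : E := (eta + 2 * eta * x1 x) *: e1 + (- (2 * ta)) *: (y - z).
  (* Splits [eta s_1^2 - ta |s|^2] into the harmonic [- (eta / d) saddle] and the positive
     [(eta / d - ta) |s|^2]. *)
  pose G s := dot g s + (- (eta / dim)) * saddle s.
  have hG : harmonic_polyfun G.
    exact: (harmonic_polyfunD (harmonic_polyfun_dot g) (harmonic_polyfunZ _ harmonic_saddle)).
  have [uC uH _] := hu; have [vC vH _] := hv.
  have ka0 : 0 < eta / dim - ta by rewrite subr_gt0.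
  apply: (no_interior_max (usc_on_usc uC) (lsc_on_usc vC) (@subset_closure _ _)
    uH vH r_gt0 ka0 hG (x := x) (y := y)) => s sr.
    have s0 := r1P s (le_trans sr rr1).
    have sr0 := le_trans sr rr0.
    split; apply/half_ball1; split; rewrite ?r0x ?r0y//.
    by move: s0; rewrite !x1D xy.
  have := shift s (le_trans sr rr0); have := r1P s (le_trans sr rr1).
  rewrite x1D => /ltW -> /(_ isT).
  rewrite /G dotx0 /saddle sqn0 !mxE !mulr0 subr0 mulr0 !addr0.
  have -> : dot g s = (eta + 2 * eta * x1 x) * x1 s + - (2 * ta) * dot (y - z) s.
    by rewrite /g [LHS]dotDl dotZl (dotZl (- (2 * ta))) dot_basis.
  rewrite -/(x1 s).
  have -> : - (eta / dim) * (sqn s - dim * (x1 s * x1 s)) =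
      eta * (x1 s * x1 s) - eta / dim * sqn s.
    by field; rewrite nat1r gt_eqF.
  by set c := eta / dim; clearbody c; lra.
have {}x0 := esym x0; split=> //.
have y0 : x1 y = 0 by rewrite -xy.
pose w : E := y - x - e; pose k : E := eps^-1 *: w.
have x1B a b : x1 (a - b) = x1 a - x1 b by rewrite /x1 !mxE.
have w0 : x1 w = 0 by rewrite /w !x1B y0 x0 e0 !subrr.
have k0 : x1 k = 0 by rewrite /x1 mxE -/(x1 w) w0 mulr0.
have ie0 : 0 < (2 * eps)^-1 by rewrite invr_gt0 mulr_gt0.
have dotk s : dot k s = 2 * (2 * eps)^-1 * dot w s.
  by rewrite /k dotZl; congr (_ * _); field; rewrite gt_eqF.
suff k00 : k = 0.
  have wE : w = eps *: k by rewrite /k scalerA mulfV ?scale1r// gt_eqF.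
  by apply/eqP; rewrite -subr_eq0 -/w wE k00 scaler0.
pose p : E := (2 * ta) *: (y - z) + k.
have dotp s : dot p s = 2 * ta * dot (y - z) s + dot k s by rewrite /p [LHS]dotDl dotZl.
have p0 : x1 p = 0 by rewrite /p x1D k0 /x1 !mxE -!/(x1 _) y0 z0 subrr mulr0 addr0.
apply: (boundary_contact (p := p) (Cu := ta + (2 * eps)^-1) (Cv := (2 * eps)^-1)
  (ta := ta) (rho := r0) hu hv xn x0 yn y0 p0 k0 eta0) => //.
- by rewrite ltr_wpDl.
- by rewrite -addrA lerDl addr_ge0// ltW.
- move=> s sr s0.
  have /maxg : levels (x, y + s).
    by apply: levelsI; rewrite ?x1D ?s0 ?x0 ?y0 ?addr0// ltW ?r0y.
  rewrite /gap x1D s0 addr0 (_ : y + s - z = (y - z) + s); last by rewrite addrAC.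
  rewrite (_ : y + s - x - e = w + s); last first.
    by rewrite /w -!addrA; congr (_ + _); rewrite addrC -!addrA.
  by rewrite -/w !sqnD_dot dotp dotk; lra.
- move=> s sr s0.
  have /maxg : levels (x + s, y).
    by apply: levelsI; rewrite ?x1D ?s0 ?x0 ?y0 ?addr0// ltW ?r0x.
  rewrite /gap (_ : y - (x + s) - e = w - s); last first.
    by apply/rowP => j; rewrite !mxE; ring.
  by rewrite -/w [sqn (w - s)]sqnD_dot sqnN dotNr dotk; lra.
- move=> s [sr s0]; have := shift s sr; rewrite x0 add0r => /(_ s0).
  have := mulr_ge0 (ltW eta0) (mulr_ge0 s0 s0).
  by rewrite dotp; lra.
Qed.

End Doubling.

(** * Sliding *)

Section Sliding.
Context {R : realType} {n : nat}.
Local Notation E := 'rV[R]_n.+1.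
Implicit Types (x y z s e w : E) (u v : E -> R).
Local Notation C := (closure (half_ball 1) : set E).
Local Notation dim := (n.+1%:R : R).

Lemma sqnD_le (t : R) x y : 0 < t ->
  sqn (x + y) <= (1 + t) * sqn x + (1 + t^-1) * sqn y.
Proof.
move=> t0; rewrite /sqn !mulr_sumr -big_split; apply: ler_sum => i _ /=.
rewrite mxE -subr_ge0; set a := x _ _; set b := y _ _.
rewrite (_ : _ - _ = t^-1 * (t * a - b) ^+ 2); last by field; rewrite gt_eqF.
by rewrite mulr_ge0 ?sqr_ge0// invr_ge0 ltW.
Qed.

Lemma compactC : compact C.
Proof. by rewrite closure_half_ball; exact: compact_half_cball. Qed.

Lemma continuous_realB (T : topologicalType) (f g : T -> R) :
  continuous f -> continuous g -> continuous (fun p => f p - g p).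
Proof. by move=> cf cg x; exact: (continuousB (cf x) (cg x)). Qed.

Lemma continuous_realM (T : topologicalType) (f g : T -> R) :
  continuous f -> continuous g -> continuous (fun p => f p * g p).
Proof. by move=> cf cg x; exact: (continuousM (cf x) (cg x)). Qed.

Lemma fst_continuous : continuous (fst : E * E -> E).
Proof. by move=> p; exact: cvg_fst. Qed.

Lemma snd_continuous : continuous (snd : E * E -> E).
Proof. by move=> p; exact: cvg_snd. Qed.

Lemma continuous_fst_comp (f : E -> R) :
  continuous f -> continuous (f \o (fst : E * E -> E)).
Proof. by move=> cf p; apply: continuous_comp; [exact: fst_continuous|exact: cf]. Qed.

Lemma continuous_snd_comp (f : E -> R) :
  continuous f -> continuous (f \o (snd : E * E -> E)).
Proof. by move=> cf p; apply: continuous_comp; [exact: snd_continuous|exact: cf]. Qed.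

Lemma sqn_diff_continuous e : continuous (fun p : E * E => sqn (p.2 - p.1 - e)).
Proof.
move=> p; apply: (@continuous_comp _ _ _ (fun p : E * E => p.2 - p.1 - e) (@sqn R n)).
  apply: continuousB; last exact: cst_continuous.
  by apply: continuousB; [exact: snd_continuous|exact: fst_continuous].
exact: sqn_continuous.
Qed.

(** Pairs with a point on the unit sphere and [u y - v x >= th] form a compact set, off the diagonal
    by the boundary inequality; [d] is its distance to the diagonal. *)
Lemma sphere_gap u v (th : R) : 0 < th -> usc C u -> usc C (fun x => - v x) ->
  (forall x, sqn x = 1 -> 0 <= x1 x -> u x <= v x) ->
  exists2 d, 0 < d & forall x y, C x -> C y -> sqn x = 1 \/ sqn y = 1 ->
    `|x - y| < d -> u y - v x < th.
Proof.
move=> th0 uC vC hbd.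
(* The vanishing product states that one of the points is on the sphere, as a closed condition. *)
pose S := (C `*` C) `&` [set p : E * E | (1 - sqn p.1) * (1 - sqn p.2) = 0].
pose K := S `&` [set p | th <= u p.2 + - v p.1].
have CC : compact (C `*` C) := compact_setX compactC compactC.
have clCC : closed (C `*` C) := compact_closed (@norm_hausdorff _ (E * E)%type) CC.
have pc : continuous (fun p : E * E => (1 - sqn p.1) * (1 - sqn p.2)).
  have c1 : continuous (fun x : E => 1 - sqn x).
    exact/polyfun_continuous/(polyfunB (polyfun_cst 1) polyfun_sqn).
  exact: (continuous_realM (continuous_fst_comp c1) (continuous_snd_comp c1)).
have clS : closed S.
  apply: closedI => //.
  apply: (closed_comp (f := fun p : E * E => (1 - sqn p.1) * (1 - sqn p.2))
    (D := [set r : R | r = 0])) => [p _|]; [exact: pc|exact: closed_eq].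
have u2 : usc S (u \o snd) by apply: (usc_comp uC) => [|p [[]]//]; exact: snd_continuous.
have v1 : usc S ((fun x => - v x) \o fst).
  by apply: (usc_comp vC) => [|p [[]]//]; exact: fst_continuous.
have cK : compact K.
  apply: (subclosed_compact _ CC) => [|p [[]]//].
  exact: (usc_closed_ge clS (uscD u2 v1)).
have inK x y : C x -> C y -> sqn x = 1 \/ sqn y = 1 -> th <= u y - v x -> K (x, y).
  move=> Cx Cy xy th_le; split=> //; split=> //=.
  by case: xy => ->; rewrite subrr ?mul0r ?mulr0.
have [K0|/set0P K0] := eqVneq K set0.
  exists 1 => // x y Cx Cy xy _; rewrite ltNge; apply/negP => /(inK x y Cx Cy xy).
  by rewrite K0.
have dc : continuous (fun p : E * E => `|p.1 - p.2|).
  move=> p; apply: (@continuous_comp _ _ _ (fun p : E * E => p.1 - p.2) Num.norm).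
    by apply: continuousB; [exact: fst_continuous|exact: snd_continuous].
  apply: norm_continuous.
have [[a b] [[[/= Ca Cb] ab1] thab] dmin] :=
  usc_max cK K0 (continuous_usc (@opp_mul_continuous R _ 1 _ dc)).
exists `|a - b|.
  rewrite normr_gt0; apply/eqP => /subr0_eq ab.
  rewrite /= ab in Ca ab1 thab.
  have b1 : sqn b = 1.
    by move/eqP: ab1; rewrite mulf_eq0 orbb subr_eq0 => /eqP.
  have := hbd b b1 (closureC_sqn Cb).2.
  by move: th0 thab; lra.
move=> x y Cx Cy xy xyd; rewrite ltNge; apply/negP => /(inK x y Cx Cy xy) /dmin /=.
by rewrite !mul1r lerN2 leNgt xyd.
Qed.

Lemma compact_levels : compact (levels : set (E * E)).
Proof.
have CC : compact (C `*` C) := compact_setX compactC compactC.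
have clCC : closed (C `*` C) := compact_closed (@norm_hausdorff _ (E * E)%type) CC.
apply: (subclosed_compact _ CC) => [|p [? []]//].
have -> : levels = (C `*` C) `&` [set p : E * E | x1 p.1 - x1 p.2 = 0].
  apply/seteqP; split=> -[x y] /= [].
    by move=> Cx [Cy xy]; split=> //; rewrite xy subrr.
  by move=> [Cx Cy] /subr0_eq xy.
apply: closedI => //.
apply: (closed_comp (f := fun p : E * E => x1 p.1 - x1 p.2)
  (D := [set r : R | r = 0])) => [p _|]; last exact: closed_eq.
exact: (continuous_realB (continuous_fst_comp x1_continuous)
  (continuous_snd_comp x1_continuous)).
Qed.

Lemma usc_gap u v (eta ta : R) z : usc C u -> usc C (fun x => - v x) ->
  usc levels (fun p => gap u v eta ta z p.1 p.2).
Proof.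
move=> uC vC.
have u2 : usc levels (u \o snd).
  by apply: (usc_comp uC) => [|p [? []]//]; exact: snd_continuous.
have v1 : usc levels ((fun x => - v x) \o fst).
  by apply: (usc_comp vC) => [|p [? []]//]; exact: fst_continuous.
have px : polyfun (fun y => eta * (x1 y + x1 y * x1 y) - ta * sqn (y - z)).
  apply: polyfunB; apply: polyfunZ; last exact/polyfun_shift/polyfun_sqn.
  by apply: polyfunD; [exact: polyfun_coord|exact: polyfun_x1sqr].
have := uscD (uscD u2 v1) (continuous_usc (continuous_snd_comp (polyfun_continuous px))).
congr usc; apply/funext => p; rewrite /gap /=; ring.
Qed.

(** The constants are fixed before [ta], [z] and [e]. This uniformity allows chaining over offsets
    and gives a contact radius independent of the point. *)
Lemma doubling_contact u v xs : supersolution v -> subsolution u ->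
  (forall x, sqn x = 1 -> 0 <= x1 x -> u x <= v x) -> C xs -> v xs < u xs ->
  exists eta ta0 eps q, [/\ 0 < eta, 0 < ta0, 0 < eps, 0 < q &
    forall ta z e, 0 <= ta <= ta0 -> C z -> x1 z = 0 -> x1 e = 0 -> sqn e <= q ->
    exists x y, [/\ C x /\ C y, x1 x = 0, y - x = e &
      forall x' y', levels (x', y') ->
        gap u v eta ta z x' y' <= gap u v eta ta z x y + sqn (y' - x' - e) / (2 * eps)]].
Proof.
move=> hv hu hbd Cxs vus; pose th := u xs - v xs; have th0 : 0 < th by rewrite subr_gt0.
have [uC _ _] := hu; have [vC _ _] := hv.
have {}uC := usc_on_usc uC; have {}vC := lsc_on_usc vC.
have dim0 : 0 < dim by rewrite ltr0n.
have th20 : 0 < th / 2 by rewrite divr_gt0.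
have [d d0 dP] := sphere_gap th20 uC vC hbd.
have C0 : C !=set0 by exists xs.
have [xu Cxu umax] := usc_max compactC C0 uC.
have [xv Cxv vmax] := usc_max compactC C0 vC.
pose B := u xu - v xv.
have Bth : th <= B by apply: lerB; [exact: umax|rewrite -lerN2 vmax].
have B0 : 0 < B := lt_le_trans th0 Bth.
(* With these [eta], [ta0] and [q], the pair [(xs, xs)] has penalized gap at least [7/8 th], so a
   maximum has [u y - v x] at least [13/16 th] plus its penalty. *)
pose eta := th / 32; have eta0 : 0 < eta by rewrite divr_gt0.
pose ta0 := Num.min (th / 64) (eta / (2 * dim)).
have ta00 : 0 < ta0 by rewrite lt_min !divr_gt0 ?mulr_gt0.
(* The penalty at a maximum is at most [B]; this [eps] then forces [|x - y| < d], and [sphere_gap]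
   keeps both points off the sphere. *)
pose eps := d ^+ 2 / (16 * B); have eps0 : 0 < eps by rewrite divr_gt0 ?exprn_gt0 ?mulr_gt0.
have epsB : eps * B = d ^+ 2 / 16 by rewrite /eps; field; rewrite gt_eqF.
clearbody eps; have e20 : 0 < 2 * eps by rewrite mulr_gt0.
pose q := eps * th / 8; have q0 : 0 < q by apply: divr_gt0 => //; exact: mulr_gt0.
exists eta, ta0, eps, q; split=> // ta z e /andP[ta_ge0 ta_le] Cz z0 e0 eq.
have ta1 : ta <= th / 64 by apply: (le_trans ta_le); rewrite ge_min lexx.
have taeta : ta < eta / dim.
  apply: (@le_lt_trans _ _ (eta / (2 * dim))).
    by apply: (le_trans ta_le); rewrite ge_min lexx orbT.
  by rewrite invfM mulrCA gtr_pMl ?divr_gt0// invf_lt1// ltr1n.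
have ie0 : 0 < (2 * eps)^-1 by rewrite invr_gt0 mulr_gt0.
have cont : continuous (fun p : E * E => - ((2 * eps)^-1 * sqn (p.2 - p.1 - e))).
  exact: (@opp_mul_continuous R (E * E)%type (2 * eps)^-1
    (fun p : E * E => sqn (p.2 - p.1 - e)) (@sqn_diff_continuous e)).
have Lxs : levels (xs, xs) by [].
have [[x y] Lxy maxg] := usc_max compact_levels (ex_intro _ _ Lxs)
  (uscD (@usc_gap u v eta ta z uC vC) (continuous_usc cont)).
have [/= Cx [Cy xy]] := Lxy.
have {}maxg x' y' : levels (x', y') ->
    gap u v eta ta z x' y' - sqn (y' - x' - e) / (2 * eps) <=
    gap u v eta ta z x y - sqn (y - x - e) / (2 * eps).
  by move=> /maxg /=; rewrite !(mulrC (2 * eps)^-1).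
have sqn4 a b : C a -> C b -> sqn (a - b) <= 4.
  move=> /closureC_sqn[a1 _] /closureC_sqn[b1 _].
  have := sqnD_le a (- b) ltr01; rewrite sqnN invr1; lra.
have x1le a : C a -> 0 <= x1 a <= 1.
  move=> /closureC_sqn[a1 a0]; rewrite a0 /=.
  have := x1_sqr_le_sqn a; nra.
have big : 7 / 8 * th <= gap u v eta ta z x y - sqn (y - x - e) / (2 * eps).
  apply: le_trans (maxg _ _ Lxs); rewrite /gap subrr sub0r sqnN.
  have /andP[xs0 xs1] := x1le xs Cxs.
  have : 0 <= eta * (x1 xs + x1 xs * x1 xs).
    by rewrite mulr_ge0 ?(ltW eta0)// addr_ge0// mulr_ge0.
  have : ta * sqn (xs - z) <= th / 64 * 4 by rewrite ler_pM ?sqn_ge0 ?sqn4.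
  have : sqn e / (2 * eps) <= th / 16.
    by rewrite ler_pdivrMr//; apply: (le_trans eq); rewrite /q; lra.
  by rewrite -/th; rewrite /th; lra.
have uvxy : 13 / 16 * th + sqn (y - x - e) / (2 * eps) <= u y - v x.
  have /andP[y0 y1] := x1le y Cy.
  have : eta * (x1 y + x1 y * x1 y) <= eta * 2.
    by rewrite ler_pM2l//; nra.
  have : 0 <= ta * sqn (y - z) by rewrite mulr_ge0 ?sqn_ge0.
  by move: big; rewrite /gap /eta; lra.
have s_ge0 : 0 <= sqn (y - x - e) / (2 * eps) by rewrite divr_ge0 ?sqn_ge0 ?(ltW e20).
have close : `|x - y| < d.
  have wB : sqn (y - x - e) <= d ^+ 2 / 8.
    have : sqn (y - x - e) / (2 * eps) <= B.
      have : u y - v x <= B by apply: lerB; [exact: umax|rewrite -lerN2 vmax].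
      by move: uvxy th0; lra.
    rewrite ler_pdivrMr//; move: epsB; lra.
  have eB : sqn e <= d ^+ 2 / 16.
    apply: (le_trans eq); rewrite -epsB /q -mulrA ler_pM2l//.
    by move: Bth th0; lra.
  rewrite distrC -(subrK e (y - x)) (le_lt_trans (ler_normD _ _))//.
  have n1 := norm_sqr_le_sqn (y - x - e); have n2 := norm_sqr_le_sqn e.
  have : `|y - x - e| < d / 2.
    rewrite -(ltr_pXn2r (n := 2))// ?nnegrE ?divr_ge0 ?(ltW d0)//.
    apply: (le_lt_trans n1); apply: (le_lt_trans wB).
    by have : 0 < d ^+ 2 by [rewrite exprn_gt0]; rewrite exprMn exprVn; lra.
  have : `|e| < d / 2.
    rewrite -(ltr_pXn2r (n := 2))// ?nnegrE ?divr_ge0 ?(ltW d0)//.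
    apply: (le_lt_trans n2); apply: (le_lt_trans eB).
    by have : 0 < d ^+ 2 by [rewrite exprn_gt0]; rewrite exprMn exprVn; lra.
  lra.
have inside : ~ (sqn x = 1 \/ sqn y = 1).
  by move=> /(dP x y Cx Cy) /(_ close); move: uvxy s_ge0 th0; lra.
have x_in : sqn x < 1.
  rewrite lt_neqAle (closureC_sqn Cx).1 andbT; apply/eqP => x_1.
  by apply: inside; left.
have y_in : sqn y < 1.
  rewrite lt_neqAle (closureC_sqn Cy).1 andbT; apply/eqP => y_1.
  by apply: inside; right.
have [x0 yx] := doubling_max_flat hv hu ta_ge0 taeta eps0 z0 e0 Lxy x_in y_in maxg.
exists x, y; split=> // x' y' /maxg; rewrite yx subrr sqn0 mul0r subr0; lra.
Qed.

(** Cutting the segment into [N] equal pieces turns the error [K] into [N (K / N^2) = K / N]. *)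
Lemma quadratic_modulus_le (D : set E) (m : E -> R) (c : R) :
  (forall e e' (t : R), D e -> D e' -> 0 <= t <= 1 -> D (e + t *: (e' - e))) ->
  0 <= c -> (forall e e', D e -> D e' -> m e <= m e' + c * sqn (e' - e)) ->
  forall e e', D e -> D e' -> m e <= m e'.
Proof.
move=> Dconv c0 mD e e' De De'; apply/ler_addgt0Pr => g g0.
pose K := c * sqn (e' - e); have K0 : 0 <= K by rewrite mulr_ge0 ?sqn_ge0.
pose N := (Num.truncn (K / g)).+1.
have N0 : 0 < N%:R :> R by rewrite ltr0n.
pose p k := e + (k%:R / N%:R) *: (e' - e).
have pD k : (k <= N)%N -> D (p k).
  move=> kN; apply: Dconv => //.
  by rewrite divr_ge0//= ler_pdivrMr// mul1r ler_nat.
have step k : (k <= N)%N -> m e <= m (p k) + k%:R * (K / N%:R ^+ 2).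
  elim: k => [_|k IH kN]; first by rewrite /p !mul0r scale0r !addr0.
  apply: (le_trans (IH (ltnW kN))).
  have := mD _ _ (pD k (ltnW kN)) (pD k.+1 kN).
  rewrite (_ : p k.+1 - p k = N%:R^-1 *: (e' - e)); last first.
    rewrite /p -natr1; apply/rowP => j; rewrite !mxE; ring.
  rewrite sqnZ exprVn mulrCA -/K (mulrC _ K) -[in X in _ -> X]natr1 mulrDl mul1r; lra.
have := step N (leqnn N); rewrite {1}/p mulfV ?gt_eqF// scale1r subrKC => /le_trans; apply.
rewrite lerD2l (_ : _ * _ = K / N%:R); last by field; rewrite gt_eqF.
by rewrite ler_pdivrMr// mulrC -ler_pdivrMr// ltW// truncnS_gt.
Qed.

Definition flat_disc (q : R) : set E := [set e | x1 e = 0 /\ sqn e <= q].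

Lemma flat_disc_convex q e e' (t : R) : flat_disc q e -> flat_disc q e' ->
  0 <= t <= 1 -> flat_disc q (e + t *: (e' - e)).
Proof.
move=> [e0 eq] [e'0 e'q] /andP[t0 t1]; split.
  by rewrite x1D e0 /x1 !mxE -!/(x1 _) e0 e'0 subrr mulr0 addr0.
apply: (@le_trans _ _ ((1 - t) * sqn e + t * sqn e')); last by nra.
rewrite /sqn !mulr_sumr -big_split; apply: ler_sum => i _ /=.
rewrite !mxE; set a := e _ _; set b := e' _ _; rewrite -subr_ge0.
rewrite (_ : _ - _ = t * (1 - t) * (b - a) ^+ 2); last by ring.
by rewrite mulr_ge0 ?sqr_ge0// mulr_ge0// subr_ge0.
Qed.

(** The largest gap [m e] among pairs of offset [e] is attained on the hyperplane and is constant on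
    the disc, so its maximizer at any offset dominates all pairs with offset in the disc. *)
Lemma sliding u v xs : supersolution v -> subsolution u ->
  (forall x, sqn x = 1 -> 0 <= x1 x -> u x <= v x) -> C xs -> v xs < u xs ->
  exists eta ta0 q, [/\ 0 < eta, 0 < ta0, 0 < q &
    forall ta z x y e, 0 <= ta <= ta0 -> C z -> x1 z = 0 -> levels (x, y) ->
    flat_disc q (y - x) -> flat_disc q e ->
    exists x' y', [/\ C x' /\ C y', x1 x' = 0, y' - x' = e &
      gap u v eta ta z x y <= gap u v eta ta z x' y']].
Proof.
move=> hv hu hbd Cxs vus.
have [eta [ta0 [eps [q [eta0 ta00 eps0 q0 H]]]]] := doubling_contact hv hu hbd Cxs vus.
exists eta, ta0, q; split=> // ta z x y e hta Cz z0 Lxy Dyx De.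
have /choice[m mP] : forall e', exists mm : R, flat_disc q e' ->
    (exists x y, [/\ C x /\ C y, x1 x = 0, y - x = e' & mm = gap u v eta ta z x y]) /\
    forall x y, levels (x, y) ->
      gap u v eta ta z x y <= mm + (2 * eps)^-1 * sqn (y - x - e').
  (* Outside the disc the value is a dummy 0. *)
  move=> e'; have [De'|nDe'] := pselect (flat_disc q e'); last by exists 0 => /nDe'.
  have [x' [y' [C' x'0 xy' max']]] := H ta z e' hta Cz z0 De'.1 De'.2.
  exists (gap u v eta ta z x' y') => _; split; first by exists x', y'.
  by move=> a b /max'; rewrite (mulrC (2 * eps)^-1).
have ie0 : 0 <= (2 * eps)^-1 by rewrite invr_ge0 mulr_ge0 ?(ltW eps0).
have mmono : forall e1 e2, flat_disc q e1 -> flat_disc q e2 -> m e1 <= m e2.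
  apply: (quadratic_modulus_le (@flat_disc_convex q) ie0) => e1 e2 D1 D2.
  have [[a [b [[Ca Cb] a0 ab ->]]] _] := mP e1 D1.
  have /((mP e2 D2).2) : levels (a, b).
    by split=> //; split=> //=; rewrite -(subrK a b) ab x1D D1.1 add0r.
  by rewrite ab -sqnN opprB.
have [[a [b [[Ca Cb] a0 ab mE]]] _] := mP e De.
exists a, b; split=> //; rewrite -mE.
have := (mP (y - x) Dyx).2 x y Lxy; rewrite subrr sqn0 mulr0 addr0 => /le_trans; apply.
exact: mmono.
Qed.

End Sliding.

(** * The contact set *)

Section ContactSet.
Context {R : realType} {n : nat}.
Local Notation E := 'rV[R]_n.+1.
Implicit Types (x y z s e w : E) (u v : E -> R) (K : set E).
Local Notation C := (closure (half_ball 1) : set E).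
Local Notation dim := (n.+1%:R : R).

Lemma sqn_eq0 x : sqn x = 0 -> x = 0.
Proof.
move=> xs; apply/eqP; rewrite -normr_eq0 -sqrf_eq0 eq_le sqr_ge0 andbT.
by rewrite -xs norm_sqr_le_sqn.
Qed.

Definition flat_nbhs (r : R) x : set E := ball x r `&` hyperplane.

Lemma flat_nbhs_connected r x : 0 < r -> x1 x = 0 -> connected (flat_nbhs r x).
Proof.
move=> r0 x0.
have -> : flat_nbhs r x = \bigcup_(y in flat_nbhs r x)
    ((fun t : R => x + t *: (y - x)) @` `[0, 1]%classic).
  apply/seteqP; split=> [y By|z [y [By y0]] [t /= t01 <-]].
    exists y => //; exists 1; first by rewrite /= in_itv/= ler01 lexx.
    by rewrite scale1r subrKC.
  move: t01; rewrite in_itv /= => /andP[t0 t1]; split; last first.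
    by rewrite /hyperplane /= x1D x0 add0r /x1 !mxE -!/(x1 _) y0 x0 subrr mulr0.
  move: By; rewrite -ball_normE /ball_ /= opprD addNKr normrN normrZ (ger0_norm t0) distrC.
  by apply: le_lt_trans; rewrite ler_piMl.
apply: bigcup_connected.
  exists x => y By /=; exists 0; first by rewrite /= in_itv/= lexx ler01.
  by rewrite scale0r addr0.
move=> y By; apply: connected_continuous_connected; first exact: segment_connected.
apply: continuous_subspaceT => t.
have cZ : continuous (fun t : R => t *: (y - x)) by move=> t'; exact: scalel_continuous.
have c0 : {for t, continuous (fun=> x : E)} by exact: cst_continuous.
exact: (continuousD c0 (cZ t)).
Qed.

Lemma flat_nbhs_center r x : 0 < r -> x1 x = 0 -> flat_nbhs r x x.
Proof. by move=> r0 x0; split=> //; exact: ballxx. Qed.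

Lemma sqn_near (r : R) x y : ball x r y -> sqn (y - x) <= dim * r ^+ 2.
Proof.
rewrite -ball_normE /ball_ /= distrC => yx; apply: (le_trans (sqn_le_norm _)).
by rewrite ler_pM2l ?ltr0n// lerXn2r ?nnegrE// ltW// (le_lt_trans _ yx).
Qed.

(* A component of a small neighborhood of [K] has no point of [K] on its
   relative boundary, so the maximum [a] attained on [K] cannot reappear there. *)
Lemma no_max_set u K (a q : R) : boundary_max_principle u ->
  compact K -> K !=set0 -> K `<=` flat_ball 1 -> 0 < q ->
  (forall x, K x -> u x = a) ->
  (forall x y, K x -> flat_ball 1 y -> sqn (y - x) <= q -> u y <= a) ->
  (forall x y, K x -> flat_ball 1 y -> sqn (y - x) <= q -> u y = a -> K y) -> False.
Proof.
move=> bmp cK K0 Kflat q0 Ka ua uaK.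
have dim0 : 0 < dim by rewrite ltr0n.
have [xm Kxm xmax] := usc_max cK K0 (polyfun_usc polyfun_sqn).
have /flat_ball1[xm1 _] := Kflat xm Kxm.
pose g := (1 - sqn xm) / 2; have g0 : 0 < g by rewrite divr_gt0// subr_gt0.
have gE : sqn xm = 1 - 2 * g by rewrite /g; lra.
clearbody g.
(* The first bound keeps points within [2 r] of [K] in the range [q] of the hypotheses, the second
   keeps the [r]-neighborhood of [K] in [|w|^2 <= 1 - g / 2]. The factors [dim] come from sup norm
   balls. *)
pose M := Num.min (q / (4 * dim)) (g / (2 * dim * (1 + g^-1))).
have ig0 : 0 < g^-1 by rewrite invr_gt0.
have ig1 : 0 < 1 + g^-1 by rewrite addr_gt0.
have M0 : 0 < M.
  by rewrite lt_min; apply/andP; split; apply: divr_gt0; rewrite ?mulr_gt0.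
pose r := Num.min 1 M; have r0 : 0 < r by rewrite lt_min ltr01.
have rr : r ^+ 2 <= M.
  have rM : r <= M by rewrite ge_min lexx orbT.
  have r1 : r <= 1 by rewrite ge_min lexx.
  by apply: le_trans rM; rewrite expr2 ler_piMl// ltW.
have rq : dim * (2 * r) ^+ 2 <= q.
  have : r ^+ 2 <= q / (4 * dim) by apply: (le_trans rr); rewrite ge_min lexx.
  by rewrite ler_pdivlMr ?mulr_gt0// exprMn; lra.
have rg : (1 + g^-1) * (dim * r ^+ 2) <= g / 2.
  have : r ^+ 2 <= g / (2 * dim * (1 + g^-1)).
    by apply: (le_trans rr); rewrite ge_min lexx orbT.
  by rewrite ler_pdivlMr ?mulr_gt0//; lra.
pose b := 1 - g / 2; have b1 : b < 1 by rewrite /b; lra.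
have near_sqn x w : K x -> ball x r w -> sqn w <= b.
  move=> Kx /sqn_near wx; rewrite -(subrKC x w).
  apply: (le_trans (sqnD_le x (w - x) g0)).
  have h1 : (1 + g^-1) * sqn (w - x) <= g / 2.
    by apply: le_trans rg; rewrite ler_pM2l.
  have h2 : (1 + g) * sqn x <= (1 + g) * (1 - 2 * g).
    rewrite ler_pM2l ?addr_gt0//; apply: (le_trans (xmax x Kx)).
    by rewrite gE.
  have : 0 <= g * g by rewrite mulr_ge0 ?(ltW g0).
  by rewrite /b; lra.
pose A := \bigcup_(x in K) flat_nbhs r x.
have Kx0 x : K x -> x1 x = 0 by move=> /Kflat /flat_ball1[].
have nbA x : K x -> flat_nbhs r x `<=` A by move=> Kx w xw; exists x.
have A0 w : A w -> x1 w = 0 by move=> [x _ [_]].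
have Ab w : A w -> sqn w <= b by move=> [x Kx [xw _]]; exact: near_sqn xw.
have [x0 Kx0'] := K0.
pose Om := connected_component A x0.
have OmA : Om `<=` A by exact: connected_component_sub.
have Ax0 : A x0 by apply: (nbA x0) => //; apply: flat_nbhs_center => //; exact: Kx0.
have Omx0 : Om x0 by exact: connected_component_refl.
have Om_nb x w : K x -> flat_nbhs r x w -> Om w -> flat_nbhs r x `<=` Om.
  move=> Kx xw Omw; rewrite /Om (same_connected_component Omw).
  by apply: connected_component_max => //; [exact: nbA|exact/flat_nbhs_connected/Kx0].
pose Cb := [set w : E | sqn w <= b /\ x1 w = 0].
have clCb : closed Cb.
  apply: (@closedI _ [set w | sqn w <= b] [set w | x1 w = 0]).
    apply: (closed_comp (f := @sqn R n) (D := [set z | z <= b])) => [x _|].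
      exact: sqn_continuous.
    exact: closed_le.
  apply: (closed_comp (f := @x1 R n) (D := [set z | z = 0])) => [x _|].
    exact: x1_continuous.
  exact: closed_eq.
have clOm : closure Om `<=` Cb.
  have -> : Cb = closure Cb by apply/closure_id.
  by apply: closureS => w /OmA Aw; split; [exact: Ab|exact: A0].
have Cb_flat : Cb `<=` flat_ball 1.
  by move=> w [wb w0]; apply/flat_ball1; split=> //; exact: le_lt_trans b1.
have cOm : compact (closure Om).
  by apply: (@compact_sqn_closed _ _ b); [exact: closed_closure|move=> w /clOm[]].
have subOm : subdomain (flat_ball 1) Om.
  split.
  - by move=> w /OmA Aw; apply: Cb_flat; split; [exact: Ab|exact: A0].
  - by exists x0.
  - exact: component_connected.
  - exists (\bigcup_(x in K `&` Om) ball x r).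
      by apply: bigcup_open => x _; exact: ball_open.
    apply/seteqP; split=> [w Omw|w [[x [Kx Omx] xw] w0]].
      have [x Kx xw] := OmA w Omw; split; last by case: xw.
      exists x; last by case: xw.
      split=> //; apply: (Om_nb x w Kx xw Omw).
      by apply: flat_nbhs_center => //; exact: Kx0.
    apply: (Om_nb x x Kx _ Omx); last by split.
    by apply: flat_nbhs_center => //; exact: Kx0.
have [m [[_ m_max] [[z [[clz clcz] z0] uz] _]]] := bmp Om subOm
  (conj cOm (subset_trans clOm Cb_flat)).
have am : a <= m.
  by rewrite -(Ka x0 Kx0'); apply: m_max; exact: subset_closure.
(* [z] is within [r] of a point of [Om], itself within [r] of a point of [K]: hence the radius [2 r]
   above. *)
have [w [Omw zw]] := clz _ (nbhsx_ballx z r r0).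
have [x Kx [xw w0]] := OmA w Omw.
have zx : sqn (z - x) <= q.
  apply: le_trans rq; apply: sqn_near; rewrite mulr2n mulrDl mul1r.
  exact: (ball_triangle xw (ball_sym zw)).
have flatz : flat_ball 1 z by exact/Cb_flat/clOm.
have uza : u z = a.
  by apply/eqP; rewrite eq_le (ua x z)//= uz.
have Kz := uaK x z Kx flatz zx uza.
have zOm : flat_nbhs r z `<=` Om by apply: (Om_nb z w Kz _ Omw); split.
have [w' [[w'0 nOm] zw']] := clcz _ (nbhsx_ballx z r r0).
by apply: nOm; apply: zOm; split.
Qed.

End ContactSet.

(** * Comparison on the half ball, through a level of the contact set *)

Theorem theorem1p6 (R : realType) (n : nat) (hd : (2 <= n.+1)%N)
    (v u : 'rV[R]_n.+1 -> R)
    (hv : supersolution v) (hu : subsolution u)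
    (humax : boundary_max_principle u)
    (hbd : forall x, esphere 0 1 x -> 0 <= x1 x -> u x <= v x) :
  forall x, closure (half_ball 1) x -> u x <= v x.
Proof.
move=> xs Cxs; rewrite leNgt; apply/negP => vus.
have hbd' x : sqn x = 1 -> 0 <= x1 x -> u x <= v x.
  move=> xn x0; apply: hbd => //; rewrite /esphere /= subr0.
  by apply/enorm_eq; rewrite ?ler01// expr1n.
have [eta [ta0 [q [eta0 ta00 q0 slide]]]] := sliding hv hu hbd' Cxs vus.
have [uC _ _] := hu; have [vC _ _] := hv.
have {}uC := usc_on_usc uC; have {}vC := lsc_on_usc vC.
have C0 : closure (half_ball 1) (0 : 'rV[R]_n.+1).
  by apply: in_closureC; rewrite ?sqn0 ?ler01// /x1 mxE.
have x00 : x1 (0 : 'rV[R]_n.+1) = 0 by rewrite /x1 mxE.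
have D0 : flat_disc q (0 : 'rV[R]_n.+1) by split; rewrite ?sqn0 ?(ltW q0).
have gapE ta z x y : x1 y = 0 -> gap u v eta ta z x y = u y - ta * sqn (y - z) - v x.
  by move=> y0; rewrite /gap y0 mulr0 addr0 mulr0 addr0.
have t00 : 0 <= (0 : R) <= ta0 by rewrite lexx ltW.
have tt0 : 0 <= ta0 <= ta0 by rewrite lexx ltW.
pose F := [set x : 'rV[R]_n.+1 | closure (half_ball 1) x /\ x1 x = 0].
have clF : closed F.
  apply: (@closedI _ (closure (half_ball 1)) [set w | x1 w = 0]).
    exact: closed_closure.
  apply: (closed_comp (f := @x1 R n) (D := [set z | z = 0])) => [x _|].
    exact: x1_continuous.
  exact: closed_eq.
have FC : F `<=` closure (half_ball 1) by move=> x [].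
(* Sliding to the offset 0 ends on the diagonal, where the gap is a value of [u - v] on the
   hyperplane, minus the localization term. *)
have slide_flat ta z x y : 0 <= ta <= ta0 -> F z ->
    levels (x, y) -> flat_disc q (y - x) ->
    exists2 w, F w & gap u v eta ta z x y <= u w - v w - ta * sqn (w - z).
  move=> hta [Cz z0] Lxy Dyx.
  have [x' [y' [[Cx' Cy'] x'0 yx]]] := slide ta z x y 0 hta Cz z0 Lxy Dyx D0.
  have {}yx : y' = x' by apply/eqP; rewrite -subr_eq0 yx.
  rewrite yx (gapE ta z x' x' x'0) => le; exists x' => //; move: le; lra.
have [xM FxM Mmax] : exists2 xM, F xM & forall x, F x -> u x - v x <= u xM - v xM.
  apply: (usc_max _ _ (uscD (usc_sub FC uC) (usc_sub FC vC))).
    exact: (subclosed_compact clF compactC FC).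
  by exists 0.
pose M := u xM - v xM.
have levF x y : F x -> F y -> levels (x, y).
  by move=> [Cx x0] [Cy y0]; split=> //; split=> //=; rewrite x0 y0.
have F_disc x y : F x -> F y -> sqn (y - x) <= q -> flat_disc q (y - x).
  by move=> [_ x0] [_ y0]; split=> //; rewrite /x1 !mxE -!/(x1 _) x0 y0 subrr.
have F0 : F 0 by [].
have uvM x y : F x -> F y -> sqn (y - x) <= q -> u y - v x <= M.
  move=> Fx Fy yx.
  have [w Fw] := slide_flat 0 0 x y t00 F0 (levF x y Fx Fy) (F_disc x y Fx Fy yx).
  rewrite gapE; last by case: Fy.
  by have := Mmax w Fw; rewrite -/M; lra.
have M0 : 0 < M.
  have Dxs : flat_disc q (xs - xs) by rewrite subrr.
  have Lxs : levels (xs, xs) by [].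
  have [w Fw] := slide_flat 0 0 xs xs t00 F0 Lxs Dxs.
  have [_ xs0] := closureC_sqn Cxs.
  have := mulr_ge0 (ltW eta0) (addr_ge0 xs0 (mulr_ge0 xs0 xs0)).
  by have := Mmax w Fw; rewrite /gap -/M; lra.
pose a := u xM.
(* Inequalities keep [K] closed under semicontinuity; maximality of [M] turns them into equalities
   ([KE]). *)
pose K := (F `&` [set x | a <= u x]) `&` [set x | M - a <= - v x].
have KE x : K x -> [/\ F x, u x = a & v x = a - M].
  move=> [[Fx /= ax] vx]; have := Mmax x Fx; rewrite -/M => ?.
  by split=> //; lra.
have KI x : F x -> a <= u x -> v x <= a - M -> K x.
  by move=> Fx ax vx; split; [split|rewrite /=; lra].
have flatF y : flat_ball 1 y -> F y.
  by move=> /flat_ball1[y1 y0]; split=> //; apply: in_closureC; rewrite ?y0 ?(ltW y1).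
apply: (no_max_set (K := K) (a := a) humax _ _ _ q0).
- apply: (subclosed_compact _ compactC) => [|x [[[]]]//].
  apply: usc_closed_ge; first exact: (usc_closed_ge clF (usc_sub FC uC)).
  by apply: (usc_sub _ vC) => x [[]].
- by exists xM; apply: KI => //; rewrite /M /a; lra.
- move=> x /KE[[Cx x0] ux vx]; apply/flat_ball1; split=> //.
  rewrite lt_neqAle (closureC_sqn Cx).1 andbT; apply/eqP => xn.
  by have := hbd' x xn; rewrite x0 lexx => /(_ isT); lra.
- by move=> x /KE[].
- move=> x y /KE[Fx ux vx] /flatF Fy yx.
  by have := uvM x y Fx Fy yx; lra.
- move=> x y /KE[Fx ux vx] /flatF Fy yx uy.
  (* Localized at [z = y], the gap of [(x, y)] is [M], while [u w - v w <= M]. The term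
     [ta0 |w - y|^2] must vanish, so [y = w] is itself a contact point. *)
  have [w Fw] := slide_flat ta0 y x y tt0 Fy (levF x y Fx Fy) (F_disc x y Fx Fy yx).
  rewrite gapE ?subrr ?sqn0 ?mulr0; last by case: Fy.
  have wM := Mmax w Fw; rewrite -/M in wM; move=> le.
  have wy : ta0 * sqn (w - y) <= 0 by lra.
  have {}wy : w = y.
    apply/eqP; rewrite -subr_eq0; apply/eqP/sqn_eq0/eqP.
    by rewrite eq_le sqn_ge0 andbT -(pmulr_rle0 _ ta00).
  by subst w; move: le; rewrite subrr sqn0 mulr0 subr0 => le; apply: KI => //; lra.
Qed.
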